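(* Let $N\ge2$ be an integer, $\mu_0,\mu_1\in\mathcal P_2(\mathbb R^d)$, and let $(\gamma_n)_{n\ge0}$ and $(\gamma_n^{(N)})_{n\ge0}$ be sequences in $\Gamma(\mu_0,\mu_1)$ generated by reflow with minibatch OT with batch size $N$, i.e. $\gamma_0\in\Gamma(\mu_0,\mu_1)$ is arbitrary and for every $n\ge0$ $$\gamma_n^{(N)}=\mathcal F_N(\gamma_n),\qquad \gamma_{n+1}\in\mathcal R(\gamma_n^{(N)}).$$ Let $\gamma$ be a limit point of $(\gamma_n)_n$ and $\gamma^{(N)}$ a limit point of $(\gamma_n^{(N)})_n$ (with respect to weak convergence). Then $\gamma$ is $N$-cyclically monotone and $$\int\|x-y\|^2\,d\gamma(x,y)=\int\|x-y\|^2\,d\gamma^{(N)}(x,y).$$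
   Context: $\mathcal P_2(\mathbb R^m)$ denotes Borel probability measures with finite second moment, and $\Gamma(\mu_0,\mu_1)$ is the set of $\gamma\in\mathcal P_2(\mathbb R^d\times\mathbb R^d)$ with first marginal $\mu_0$ and second marginal $\mu_1$. Minibatch OT operator: let $\Sigma_N$ be the group of permutations of $\{1,\dots,N\}$. Fix a Borel map $S=(S_1,\dots,S_N):(\mathbb R^d\times\mathbb R^d)^N\to(\mathbb R^d\times\mathbb R^d)^N$ which sends $(x^{(i)},y^{(i)})_{i=1}^N$ to $(x^{(i)},y^{(\sigma(i))})_{i=1}^N$, where $\sigma$ (depending measurably on the input, otherwise an arbitrary but fixed choice) satisfies $\sigma\in\arg\min_{\tau\in\Sigma_N}\sum_{i=1}^N\|x^{(i)}-y^{(\tau(i))}\|^2$. Set $\mathcal F_N(\gamma)=\frac1N\sum_{i=1}^N (S_i)_\#\gamma^{\otimes N}$. A plan $\gamma$ is $N$-cyclically monotone if for all $(x^{(1)},y^{(1)}),\dots,(x^{(N)},y^{(N)})\in\mathrm{supp}(\gamma)$ and all $\tau\in\Sigma_N$, $\sum_{i=1}^N\|x^{(i)}-y^{(i)}\|^2\le\sum_{i=1}^N\|x^{(i)}-y^{(\tau(i))}\|^2$. For $\gamma\in\Gamma(\mu_0,\mu_1)$ the interpolation $\mu_t$ ($t\in[0,1]$) is the law of $(1-t)x+ty$ under $\gamma$. The flow matching loss is $\mathcal L(w_t|\gamma)=\int_0^1\int\|w_t((1-t)x+ty)-y+x\|^2\,d\gamma(x,y)\,dt$, for Borel vector fields $w:(t,x)\mapsto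 w_t(x)\in\mathbb R^d$ with $\int_0^1\int\|w_t\|^2d\mu_t\,dt<\infty$. The velocity field $v_t$ of $\gamma$ is the minimizer of $\mathcal L(\cdot|\gamma)$ over such fields; it is unique up to $\mu_t\otimes dt$-null sets. Weak rectified couplings: $\mathcal R(\gamma)$ is the set of all $\tilde\gamma$ for which there is a Borel probability measure $\Lambda$ on curves $\lambda:[0,1]\to\mathbb R^d$ (on $C([0,1];\mathbb R^d)$, concentrated on absolutely continuous curves) such that: (a) $\dot\lambda(t)=v_t(\lambda(t))$ for a.e. $t$ and $\Lambda$-a.e. $\lambda$; (b) $\int\psi\,d\mu_t=\int\psi(\lambda(t))\,d\Lambda(\lambda)$ for all $\psi\in C_c(\mathbb R^d)$ and all $t\in[0,1]$; (c) $\int\psi(x,y)\,d\tilde\gamma(x,y)=\int\psi(\lambda(0),\lambda(1))\,d\Lambda(\lambda)$ for all $\psi\in C_c^\infty(\mathbb R^d\times\mathbb R^d)$. *)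

(* Defs.v *)
From HB Require Import structures.
From mathcomp Require Import all_boot all_order all_algebra all_fingroup.
From mathcomp Require Import all_classical all_reals all_analysis.
Import Order.TTheory GRing.Theory Num.Theory.
Import numFieldNormedType.Exports.

Set Implicit Arguments.
Unset Strict Implicit.
Unset Printing Implicit Defensive.

Local Open Scope classical_set_scope.
Local Open Scope ring_scope.

(* Borel sigma-algebra on matrices, hence on R^d = 'rV[R]_d. The space
   R^d * R^d then carries the product sigma-algebra, which is its Borel
   sigma-algebra because R^d is second countable. *)
HB.instance Definition _ (R : realType) (m n : nat) :=
  Measurable.copy 'M[R]_(m, n) (g_sigma_algebraType (@open 'M[R]_(m, n))).

Section TuplePower.
Context d (T : measurableType d) (R : realType).

Definition cons_pair (n : nat) (p : T * n.-tuple T) : n.+1.-tuple T :=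
  [the n.+1.-tuple T of p.1 :: p.2].

Lemma measurable_cons_pair n : measurable_fun setT (@cons_pair n).
Proof. exact: measurable_cons. Qed.

HB.instance Definition _ n :=
  isMeasurableFun.Build _ _ _ _ (@cons_pair n) (@measurable_cons_pair n).

Fixpoint power_probability (P : probability T R) (n : nat) :
    probability (n.-tuple T) R :=
  if n is n'.+1 then
    distribution (P \x power_probability P n')%E (@cons_pair n')
  else dirac [tuple].

End TuplePower.

Section Euclidean.
Context (R : realType) (d : nat).
Local Notation Rd := 'rV[R]_d.

(* The library norm of 'rV[R]_d is the max norm. *)
Definition enorm (x : Rd) : R := Num.sqrt (\sum_(i < d) x ord0 i ^+ 2).

Definition P2 (mu : probability Rd R) :=
  (\int[mu]_x (enorm x ^+ 2)%:E < +oo)%E.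

Definition coupling (mu0 mu1 : probability Rd R)
    (gamma : probability (Rd * Rd)%type R) :=
  [/\ (\int[gamma]_p (enorm p.1 ^+ 2 + enorm p.2 ^+ 2)%:E < +oo)%E,
      forall A, measurable A -> pushforward gamma fst A = mu0 A &
      forall A, measurable A -> pushforward gamma snd A = mu1 A].

End Euclidean.

Section WeakConvergence.
Context (R : realType) (d : nat).
Local Notation X := ('rV[R]_d * 'rV[R]_d)%type.

Definition weak_cvg (P_ : nat -> probability X R) (P : probability X R) :=
  forall f : X -> R, continuous f -> bounded_fun f ->
    (\int[P_ n]_x (f x)%:E)%E @[n --> \oo] --> (\int[P]_x (f x)%:E)%E.

(* Subsequential limits: the weak topology on probability measures over a
   separable metric space is metrizable. *)
Definition weak_limit_point (P_ : nat -> probability X R)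
    (P : probability X R) :=
  exists2 phi : nat -> nat, {homo phi : m n / (m < n)%N} &
    weak_cvg (P_ \o phi) P.

Definition supp (P : probability X R) : set X :=
  [set x | forall U, open_nbhs x U -> (0 < P U)%E].

End WeakConvergence.

Section Minibatch.
Context (R : realType) (d N : nat).
Local Notation Rd := 'rV[R]_d.
Local Notation X := (Rd * Rd)%type.
Implicit Types (z : N.-tuple X) (tau : 'S_N) (gamma : probability X R).

Definition batch_cost z tau : R :=
  \sum_(i < N) enorm ((tnth z i).1 - (tnth z (tau i)).2) ^+ 2.

(* Measurability of sigma makes the map S = (rematch sigma i)_i Borel. *)
Definition ot_selection (sigma : N.-tuple X -> 'S_N) :=
  (forall tau, measurable [set z | sigma z = tau]) /\
  (forall z tau, batch_cost z (sigma z) <= batch_cost z tau).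

Definition rematch (sigma : N.-tuple X -> 'S_N) (i : 'I_N) z : X :=
  ((tnth z i).1, (tnth z (sigma z i)).2).

Definition minibatch_ot (sigma : N.-tuple X -> 'S_N) gamma :
    set X -> \bar R :=
  fun A => ((N%:R^-1)%:E * \sum_(i < N)
    pushforward (power_probability gamma N) (rematch sigma i) A)%E.

Definition cyclically_monotone gamma :=
  forall z, (forall i, supp gamma (tnth z i)) ->
  forall tau, batch_cost z 1%g <= batch_cost z tau.

End Minibatch.

Section FlowMatching.
Context (R : realType) (d : nat).
Local Notation Rd := 'rV[R]_d.
Local Notation X := (Rd * Rd)%type.
Implicit Types (gamma : probability X R) (w : R -> Rd -> Rd).

Definition interp (t : R) (p : X) : Rd := (1 - t) *: p.1 + t *: p.2.

Definition interpolation gamma (t : R) : set Rd -> \bar R :=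
  pushforward gamma (interp t).

Definition admissible_field gamma w :=
  @measurable_fun _ _ (R * Rd)%type Rd (`[0, 1] `*` setT)
    (fun tx => w tx.1 tx.2) /\
  (\int[lebesgue_measure]_(t in `[0%R, 1%R])
     \int[interpolation gamma t]_x (enorm (w t x) ^+ 2)%:E < +oo)%E.

Definition flow_matching_loss gamma w : \bar R :=
  (\int[lebesgue_measure]_(t in `[0%R, 1%R])
     \int[gamma]_p (enorm (w t (interp t p) - p.2 + p.1) ^+ 2)%:E)%E.

Definition velocity_field gamma w :=
  admissible_field gamma w /\
  forall w', admissible_field gamma w' ->
    (flow_matching_loss gamma w <= flow_matching_loss gamma w')%E.

End FlowMatching.

Section Curves.
Context (R : realType) (d : nat).
Local Notation Rd := 'rV[R]_d.
Import ArrowAsUniformType.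

(* C([0,1]; R^d), with the topology of uniform convergence and the associated
   Borel sigma-algebra *)
Definition curve := continuousType (`[0, 1]%classic : set R) Rd.

Lemma curve0_continuous :
  continuous (fun _ : (`[0, 1]%classic : set R) => 0 : Rd).
Proof. by move=> x; exact: cst_continuous. Qed.

HB.instance Definition _ := Uniform.on curve.
HB.instance Definition _ := isPointed.Build curve (mkcts curve0_continuous).
HB.instance Definition _ :=
  Measurable.copy curve (g_sigma_algebraType (@open curve)).

(* extension by 0 outside [0,1], used only to evaluate at times t : R *)
Definition curve_at (l : curve) : R -> Rd := valL_ 0 (l : _ -> Rd).

Definition absolutely_continuous (f : R -> Rd) :=
  forall e : R, 0 < e -> exists2 delta : R, 0 < delta &
  forall (n : nat) (a b : 'I_n -> R),
    (forall i, [/\ 0 <= a i, a i <= b i & b i <= 1]) ->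
    trivIset [set: 'I_n] (fun i => `]a i, b i[%classic) ->
    \sum_(i < n) (b i - a i) < delta ->
    \sum_(i < n) enorm (f (b i) - f (a i)) < e.

End Curves.

Section TestFunctions.
Context (R : realType) (V : normedModType R).

Definition compactly_supported (f : V -> R) :=
  compact (closure [set x | f x != 0]).

(* On a finite-dimensional V this is the usual class C^k: iterated derivatives
   along all (equivalently, basis) directions exist and are continuous. *)
Fixpoint C_k (k : nat) (f : V -> R) : Prop :=
  continuous f /\
  if k is k'.+1 then
    forall v, (forall x, derivable f x v) /\ C_k k' (fun x => 'D_v f x)
  else True.

Definition smooth (f : V -> R) := forall k, C_k k f.

End TestFunctions.

Section Rectification.
Context (R : realType) (d : nat).
Local Notation Rd := 'rV[R]_d.
Local Notation X := (Rd * Rd)%type.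

(* The velocity field is unique only up to null sets of mu_t (x) dt; the
   condition on Lambda does not depend on the representative v, by the
   marginal condition. The derivative is two-sided, whence `]0, 1[. *)
Definition weak_rectified (gamma gamma' : probability X R) :=
  exists (v : R -> Rd -> Rd) (Lambda : probability (curve R d) R),
  [/\ velocity_field gamma v,
      {ae Lambda, forall l, absolutely_continuous (curve_at l)},
      {ae Lambda, forall l, {ae lebesgue_measure, forall t : R,
        t \in `]0, 1[ -> is_derive t 1 (curve_at l) (v t (curve_at l t))}},
      forall psi : Rd -> R, continuous psi -> compactly_supported psi ->
        forall t, t \in `[0, 1] ->
        (\int[interpolation gamma t]_x (psi x)%:E =
         \int[Lambda]_l (psi (curve_at l t))%:E)%E &
      forall psi : X -> R, smooth psi -> compactly_supported psi ->
        (\int[gamma']_p (psi p)%:E =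
         \int[Lambda]_l (psi (curve_at l 0%R, curve_at l 1%R))%:E)%E].

End Rectification.

(* Main.v *)
(* The transport cost int |x - y|^2 decreases along the iteration. The minibatch
   step lowers it by the mean excess of the given matching of N samples over an
   optimal one. Reflow lowers it because the minimality of v gives
   int int |v_t|^2 dmu_t dt <= cost, while for an absolutely continuous curve
   |l(1) - l(0)|^2 <= int |l'|^2. Hence the costs of gamma_n and gamma_n^(N) have
   a common limit, and the cost passes to weak limits since the fixed marginals
   make |x - y|^2 uniformly integrable. If gamma were not N-cyclically monotone,
   the excess would be bounded below on a product of small boxes around N points
   of supp gamma, whose gamma_n-masses stay bounded away from 0 along the
   subsequence, so the cost would drop by a fixed amount infinitely often. *)
Require Import Defs.
From HB Require Import structures.
From mathcomp Require Import all_boot all_order all_algebra all_fingroup.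
From mathcomp Require Import all_classical all_reals all_analysis.
From mathcomp Require Import measurable_realfun.
From mathcomp Require Import ring lra.
Import Order.TTheory GRing.Theory Num.Theory.
Import numFieldNormedType.Exports.

Local Open Scope classical_set_scope.
Local Open Scope ring_scope.

Set Implicit Arguments.
Unset Strict Implicit.
Unset Printing Implicit Defensive.

(** * Measurability and the Euclidean norm on R^d *)

(** Two obstacles shape the proof. A weak rectified coupling is tied to [Lambda] by compactly
    supported tests only, whereas the velocity is merely Borel and the cost is unbounded. At each
    fixed time the tests determine the law, which then integrates every nonnegative Borel function;
    at the endpoints an inequality suffices, and it comes from smooth cutoffs increasing to the
    cost. Secondly, a curve is differentiable only at almost every time. Its increment is bounded by
    the integral of its speed through a covering argument: the exceptional times lie in a small open
    set, where absolute continuity takes over. The energy bound does not go through conditional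
    expectations; it tests the minimality of [v] against its own multiples. Finally, the two cost
    sequences interlace and so converge as full sequences, which is why the two limit points may be
    reached along unrelated subsequences. *)

Lemma open_measurable_rV (R : realType) (d : nat) (U : set 'rV[R]_d) :
  open U -> measurable U.
Proof. exact: sub_sigma_algebra. Qed.

(* The product sigma-algebra generates the Borel one because R^d has a
   countable basis, here the boxes with rational centers. *)
Lemma measurable_fun_rVP d' (T : measurableType d') (R : realType) (d : nat)
    (D : set T) (f : T -> 'rV[R]_d) : measurable D ->
  (forall i, measurable_fun D (fun t => f t ord0 i)) -> measurable_fun D f.
Proof.
move=> mD mf.
apply: (measurability (@open 'rV[R]_d)) => // _ [U oU <-].
pose box (qn : 'rV[rat]_d * nat) : set 'rV[R]_d :=
  [set x | forall i, `|x ord0 i - ratr (qn.1 ord0 i)| < qn.2.+1%:R^-1].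
have UE : U = \bigcup_(qn in [set qn | box qn `<=` U]) box qn.
  apply/seteqP; split=> [x Ux|x [qn /= h /h]//].
  have [e /= e0 xeU] : nbhs_ball x U.
    by apply/nbhs_ballP; rewrite openE in oU; exact: oU.
  have e20 : 0 < e / 2 by rewrite divr_gt0.
  have [n ne] : exists n, n.+1%:R^-1 < e / 2.
    near \oo => n; exists n; near: n.
    exact: near_infty_natSinv_lt (PosNum e20).
  have hq i : exists q : rat, `|x ord0 i - ratr q| < n.+1%:R^-1.
    have /rat_in_itvoo[q] : x ord0 i < x ord0 i + n.+1%:R^-1.
      by rewrite ltrDl invr_gt0.
    rewrite in_itv/= => /andP[h1 h2]; exists q.
    by rewrite distrC ger0_norm ?subr_ge0 ?ltW// ltrBlDl.
  exists (\row_i projT1 (cid (hq i)), n) => /=.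
    move=> y /= By; apply: xeU; split=> // i j; rewrite (ord1 i) /ball/=.
    have := By j; rewrite mxE; case: cid => /= q hxq hyq.
    rewrite -(subrK (ratr q) (x ord0 j)) -addrA (splitr e).
    apply: le_lt_trans (ler_normD _ _) _; apply: ltrD; first exact: lt_trans ne.
    by rewrite distrC; exact: lt_trans ne.
  by move=> i /=; rewrite mxE; case: cid.
rewrite UE preimage_bigcup setI_bigcupr bigcup_mkcond.
apply: countable_bigcupT_measurable => //= qn; case: ifPn => // _.
(* Passing to the complement turns the intersection over coordinates into a countable union of
   closed conditions, each on a single coordinate. *)
have -> : D `&` f @^-1` box qn = D `\` \bigcup_(i : 'I_d)
   (D `&` (fun t => f t ord0 i) @^-1`
      [set y | qn.2.+1%:R^-1 <= `|y - ratr (qn.1 ord0 i)|]).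
  apply/seteqP; split => [t [Dt Bt]|t [Dt Bt]]; split => //.
    by move=> [i _ [_]] /=; rewrite leNgt Bt.
  move=> i; rewrite ltNge; apply/negP => H; apply: Bt; exists i => //.
apply: measurableD => //; apply: countable_bigcupT_measurable => // i.
apply: mf => //; apply: closed_measurable.
have c : continuous (fun y : R => `|y - ratr (qn.1 ord0 i)|).
  by move=> y; apply: cvg_norm; apply: cvgB => //; exact: cvg_cst.
rewrite (_ : [set y | _] = (fun y => `|y - ratr (qn.1 ord0 i)|) @^-1`
  [set x | qn.2.+1%:R^-1 <= x])//.
by apply: closed_comp => [y _|]; [exact: c|exact: closed_ge].
Unshelve. all: by end_near. Qed.

Lemma measurable_fun_open_preimage d' (T : measurableType d') (R : realType)
    (f : T -> R) :
  (forall V : set R, open V -> measurable (f @^-1` V)) ->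
  measurable_fun setT f.
Proof.
move=> mf; apply: (measurability (@RGenOpens.G R)).
  exact: RGenOpens.measurableE.
by move=> _ [_ [a [b ->]] <-]; rewrite setTI; apply: mf; exact: interval_open.
Qed.

Lemma continuous_measurable_rV (R : realType) (d : nat) (f : 'rV[R]_d -> R) :
  continuous f -> measurable_fun setT f.
Proof.
move=> cf; apply: measurable_fun_open_preimage => V oV.
by apply: open_measurable_rV; apply: open_comp oV => x _; exact: cf.
Qed.

Lemma measurable_coord (R : realType) (d : nat) i :
  measurable_fun setT (fun x : 'rV[R]_d => x ord0 i).
Proof. by apply: continuous_measurable_rV => x; exact: coord_continuous. Qed.

Lemma measurable_fun_coord d' (T : measurableType d') (R : realType) (d : nat)
    (D : set T) (f : T -> 'rV[R]_d) i :
  measurable_fun D f -> measurable_fun D (fun t => f t ord0 i).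
Proof. by move=> mf; exact: (measurableT_comp (@measurable_coord R d i) mf). Qed.

Lemma continuous_sum (T : topologicalType) (R : realType) (I : Type) (s : seq I)
    (f : I -> T -> R) :
  (forall i, continuous (f i)) -> continuous (fun x => \sum_(i <- s) f i x).
Proof.
move=> cf x; elim: s => [|i s IHs].
  by under eq_fun do rewrite big_nil; exact: cvg_cst.
by under eq_fun do rewrite big_cons; apply: cvgD => //; exact: cf.
Qed.

Section EuclideanNorm.
Variables (R : realType) (d : nat).
Implicit Types x y : 'rV[R]_d.

Lemma enorm_ge0 x : 0 <= enorm x. Proof. exact: sqrtr_ge0. Qed.

Lemma enorm2E x : enorm x ^+ 2 = \sum_(i < d) x ord0 i ^+ 2.
Proof. by rewrite sqr_sqrtr// sumr_ge0// => i _; exact: sqr_ge0. Qed.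

Lemma enormZ a x : enorm (a *: x) = `|a| * enorm x.
Proof.
rewrite /enorm -sqrtr_sqr -sqrtrM ?sqr_ge0// mulr_sumr.
by congr (Num.sqrt _); apply: eq_bigr => i _; rewrite mxE exprMn.
Qed.

Lemma enorm0 : enorm (0 : 'rV[R]_d) = 0.
Proof. by rewrite -(scale0r 0) enormZ normr0 mul0r. Qed.

Lemma enormN x : enorm (- x) = enorm x.
Proof. by rewrite -scaleN1r enormZ normrN normr1 mul1r. Qed.

Lemma enormB x y : enorm (x - y) = enorm (y - x).
Proof. by rewrite -enormN opprB. Qed.

(** Cauchy-Schwarz. Expanding a sum of squares [(b x_i - a y_i)^2] with positive upper bounds [a],
    [b] of the norms avoids dividing by a norm that may vanish; the bounds are then lowered to the
    norms. *)
Lemma le_dot_enorm x y :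
  \sum_(i < d) x ord0 i * y ord0 i <= enorm x * enorm y.
Proof.
have h a b : 0 < a -> 0 < b ->
    enorm x <= a -> enorm y <= b -> \sum_(i < d) x ord0 i * y ord0 i <= a * b.
  move=> a0 b0 xa yb.
  have : 0 <= \sum_(i < d) (b * x ord0 i - a * y ord0 i) ^+ 2.
    by apply: sumr_ge0 => i _; exact: sqr_ge0.
  have -> : \sum_(i < d) (b * x ord0 i - a * y ord0 i) ^+ 2 =
      b ^+ 2 * enorm x ^+ 2 + a ^+ 2 * enorm y ^+ 2 -
      2 * (a * b) * \sum_(i < d) x ord0 i * y ord0 i.
    rewrite !enorm2E !mulr_sumr -big_split/= -sumrB.
    by apply: eq_bigr => i _; ring.
  have xa2 : enorm x ^+ 2 <= a ^+ 2 by rewrite ler_sqr ?nnegrE ?enorm_ge0// ltW.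
  have yb2 : enorm y ^+ 2 <= b ^+ 2 by rewrite ler_sqr ?nnegrE ?enorm_ge0// ltW.
  set s := \sum_(i < d) _ => h.
  have ab0 : 0 < a * b by rewrite mulr_gt0.
  rewrite -(ler_pM2l ab0).
  have := ler_wpM2l (sqr_ge0 b) xa2; have := ler_wpM2l (sqr_ge0 a) yb2.
  nra.
apply/ler_addgt0Pr => e e0.
pose m := enorm x + enorm y + 1.
have m0 : 0 < m by rewrite ltr_wpDl// addr_ge0// enorm_ge0.
(* Since [f <= 1], the product of the two enlarged norms exceeds [enorm x * enorm y] by at most
   [f * m], hence by at most [e]. *)
pose f := Num.min 1 (e / (m + 1)).
have f0 : 0 < f by rewrite lt_min ltr01 divr_gt0// addr_gt0.
have f1 : f <= 1 by rewrite ge_min lexx.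
have f2 : f * (m + 1) <= e.
  have m1 : 0 < m + 1 by rewrite addr_gt0.
  by rewrite -(ler_pdivlMr _ _ m1) /f ge_min lexx orbT.
apply: le_trans (h (enorm x + f) (enorm y + f) _ _ _ _) _.
- by rewrite ltr_wpDl// enorm_ge0.
- by rewrite ltr_wpDl// enorm_ge0.
- by rewrite lerDl ltW.
- by rewrite lerDl ltW.
- have := enorm_ge0 x; have := enorm_ge0 y; rewrite /m in f2; nra.
Qed.

Lemma ler_enormD x y : enorm (x + y) <= enorm x + enorm y.
Proof.
rewrite -ler_sqr ?nnegrE ?addr_ge0 ?enorm_ge0// sqrrD.
have -> : enorm (x + y) ^+ 2 = enorm x ^+ 2 + enorm y ^+ 2 +
    2 * \sum_(i < d) x ord0 i * y ord0 i.
  rewrite !enorm2E mulr_sumr -!big_split/=.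
  by apply: eq_bigr => i _; rewrite mxE; ring.
by have := le_dot_enorm x y; lra.
Qed.

Lemma coord_le_enorm x i : `|x ord0 i| <= enorm x.
Proof.
rewrite -ler_sqr ?nnegrE ?enorm_ge0// real_normK ?num_real// enorm2E.
by rewrite (bigD1 i)//= lerDl sumr_ge0// => j _; exact: sqr_ge0.
Qed.

Lemma enorm_continuous : continuous (@enorm R d).
Proof.
move=> x; apply: (@continuous_comp _ _ _ _ Num.sqrt); last exact: sqrt_continuous.
apply: continuous_sum => i {}x.
apply: (@continuous_comp _ _ _ (fun x => x ord0 i) (fun y : R => y ^+ 2)).
  exact: coord_continuous.
exact: exprn_continuous.
Qed.

Lemma measurable_fun_enorm d' (T : measurableType d') (D : set T)
    (f : T -> 'rV[R]_d) :
  measurable_fun D f -> measurable_fun D (fun t => enorm (f t)).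
Proof.
move=> mf.
exact: (measurableT_comp (continuous_measurable_rV enorm_continuous) mf).
Qed.

Lemma measurable_fun_rVD d' (T : measurableType d') (D : set T)
    (f g : T -> 'rV[R]_d) : measurable D ->
  measurable_fun D f -> measurable_fun D g ->
  measurable_fun D (fun t => f t + g t).
Proof.
move=> mD mf mg; apply: measurable_fun_rVP => // i; under eq_fun do rewrite mxE.
by apply: measurable_funD; exact: measurable_fun_coord.
Qed.

Lemma measurable_fun_rVZ d' (T : measurableType d') (D : set T)
    (k : T -> R) (f : T -> 'rV[R]_d) : measurable D ->
  measurable_fun D k -> measurable_fun D f ->
  measurable_fun D (fun t => k t *: f t).
Proof.
move=> mD mk mf; apply: measurable_fun_rVP => // i; under eq_fun do rewrite mxE.
by apply: measurable_funM => //; exact: measurable_fun_coord.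
Qed.

Lemma measurable_fun_rVB d' (T : measurableType d') (D : set T)
    (f g : T -> 'rV[R]_d) : measurable D ->
  measurable_fun D f -> measurable_fun D g ->
  measurable_fun D (fun t => f t - g t).
Proof.
move=> mD mf mg; apply: measurable_fun_rVP => // i; under eq_fun do rewrite !mxE.
by apply: measurable_funB; exact: measurable_fun_coord.
Qed.

End EuclideanNorm.

(** * Increments of absolutely continuous functions *)

(** Compactness of the segment in the form of Cousin's lemma: [delta] may depend on [t] without any
    control, because the supremum of the endpoints reached from [a] is itself a tag, whose interval
    overshoots it. *)
Lemma cousin_induction (R : realType) (P : R -> R -> Prop) (a b : R) :
  a <= b ->
  (forall x y z, a <= x -> x <= y -> y <= z -> z <= b ->
    P x y -> P y z -> P x z) ->
  (forall t, a <= t -> t <= b -> exists2 delta, 0 < delta &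
    forall x y, a <= x -> x <= t -> t <= y -> y <= b ->
      t - delta < x -> y < t + delta -> P x y) ->
  P a b.
Proof.
move=> ab Ptrans Ploc.
pose S := [set s | [/\ a <= s, s <= b & P a s]].
have Sa : S a.
  split=> //; have [e e0 h] := Ploc a (lexx a) ab.
  by apply: h => //; [rewrite ltrBlDr ltrDl|rewrite ltrDl].
have hS : has_sup S by split; [exists a|exists b => s []].
pose c := sup S.
have ac : a <= c by apply: ub_le_sup => //; exact: (hS.2).
have cb : c <= b by apply: ge_sup; [exists a|move=> s []].
have [e e0 h] := Ploc c ac cb.
have [s [sa sb Pas] cs] : exists2 s, S s & c - e < s.
  by apply: sup_adherent.
have sc : s <= c by apply: ub_le_sup; [exact: (hS.2)|].
have Pc y : c <= y -> y <= b -> y < c + e -> P a y.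
  move=> cy yb yce.
  by apply: (Ptrans a s y) => //; [exact: le_trans cy|exact: h].
have [cltb|] := ltP c b; last first.
  by move=> bc; apply: Pc; rewrite ?cb//; apply: le_lt_trans bc _; rewrite ltrDl.
pose y := Num.min b (c + e / 2).
have cy : c < y by rewrite lt_min cltb ltrDl divr_gt0.
have yb : y <= b by rewrite ge_min lexx.
(* A reachable point strictly beyond the supremum [c]. *)
have : S y.
  split=> //; first exact: le_trans ac (ltW cy).
  apply: Pc => //; first exact: ltW.
  rewrite gt_min ltrD2l; apply/orP; right; rewrite ltr_pdivrMr//; lra.
move=> /(ub_le_sup hS.2); rewrite -/c => yc.
by have := lt_le_trans cy yc; rewrite ltxx.
Qed.

(** The strict inequality is the room in which the norm of the difference quotient, close to
    [enorm D], stays below [M]. *)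
Lemma is_derive_enorm_lt (R : realType) (d : nat) (f : R -> 'rV[R]_d) (t : R)
    (D : 'rV[R]_d) (M : R) :
  is_derive t 1 f D -> enorm D < M ->
  \forall s \near t, enorm (f s - f t) <= M * `|s - t|.
Proof.
move=> [df dE] DM.
have M0 : 0 <= M by apply: ltW; apply: le_lt_trans DM; exact: enorm_ge0.
have cv : (fun h => enorm (h^-1 *: ((f \o shift t) (h *: (1 : R^o)) - f t)))
    @ 0^' --> enorm D.
  rewrite -dE; apply: continuous_cvg; first exact: enorm_continuous.
  exact: df.
have : \forall h \near 0^', enorm (f (h + t) - f t) <= M * `|h|.
  near=> h.
  have h0 : h != 0 by near: h; exact: nbhs_dnbhs_neq.
  have : enorm (h^-1 *: ((f \o shift t) (h *: (1 : R^o)) - f t)) < M.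
    by near: h; exact: cvgr_lt _ cv _ DM.
  rewrite enormZ/= [h *: _]mulr1 normfV mulrC.
  by rewrite ltr_pdivrMr ?normr_gt0// => /ltW.
rewrite near_withinE => nh; near=> s.
have [->|st] := eqVneq s t.
  by rewrite !subrr enorm0 normr0 mulr0.
rewrite -[in f s](subrK t s).
have : s - t != 0 by rewrite subr_eq0.
near: s.
have cs : (fun s : R => s - t) @ t --> (0 : R).
  by rewrite -[X in _ --> X](subrr t); apply: cvgB => //; exact: cvg_cst.
exact: (cs _ nh).
Unshelve. all: by end_near. Qed.

Section AbsolutelyContinuousIncrement.
Local Open Scope ereal_scope.
Variables (R : realType) (d : nat).
Local Notation mu := (@lebesgue_measure R).

Lemma measure_open_itvocD (U : set R) (x y z : R) : measurable U ->
  (x <= y)%R -> (y <= z)%R ->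
  mu (U `&` `]x, z]) = mu (U `&` `]x, y]) + mu (U `&` `]y, z]).
Proof.
move=> mU xy yz; rewrite -measureU//=.
- rewrite -setIUr -itv_bndbnd_setU//.
- exact: measurableI.
- exact: measurableI.
- apply/seteqP; split=> // t [[_ /=]] /[swap] -[_] /=.
  rewrite !in_itv/= => /andP[yt _] /andP[_ ty].
  by move: (lt_le_trans yt ty); rewrite ltxx.
Qed.

(* [U k] is an open set of almost the same measure as the level set
   [k e <= g < (k + 1) e] that it contains. *)
Lemma local_majorant (g : R -> R) (e : R) :
  @measurable_fun _ _ R R `[0%R, 1%R] g -> (forall t, 0 <= g t)%R -> (0 < e)%R ->
  exists U : nat -> set R,
  [/\ forall k, open (U k),
      forall t, (0 <= t <= 1)%R -> exists2 k, U k t & (g t < k.+1%:R * e)%R &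
      \sum_(k <oo) (k.+1%:R * e)%:E * mu (U k `&` `]0%R, 1%R]) <=
      \int[mu]_(t in `[0%R, 1%R]) (g t)%:E + (e + e)%:E].
Proof.
move=> mg g0 e0.
pose E k := `[0%R, 1%R] `&` g @^-1` `[(k%:R * e)%R, (k.+1%:R * e)%R[.
have mE k : measurable (E k) by apply: mg.
have EI k : E k `<=` `[0%R, 1%R] by move=> ? [].
have mu1 : mu `[0%R, 1%R] = 1.
  by rewrite lebesgue_measure_itv/= lte_fin ltr01 oppr0 adde0.
have Efin k : mu (E k) < +oo.
  apply: le_lt_trans (ltry 1); rewrite -mu1; apply: le_measure; rewrite ?inE//.
  exact: mE.
(* After multiplication by the height [k.+1%:R * e], the excess measure of [U k] costs
   [e / 2^(k+1)], which sums to [e]. *)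
pose eta k := (e / (2 ^ k.+1)%:R / (k.+1%:R * e))%R.
have eta0 k : (0 < eta k)%R.
  by rewrite !divr_gt0 ?mulr_gt0// ltr0n expn_gt0.
have /choice[U hU] k := lebesgue_regularity_outer (mE k) (Efin k) (eta0 k).
have oU k : open (U k) by case: (hU k).
have mU k : measurable (U k) by apply: open_measurable.
exists U; split=> //.
  move=> t t01; pose k := Num.truncn (g t / e).
  have ge0 : (0 <= g t / e)%R by rewrite divr_ge0// ltW.
  have /andP[h1 h2] := truncn_itv ge0.
  exists k; last by rewrite -ltr_pdivrMr.
  have [_ + _] := hU k; apply; split; first by rewrite /= in_itv.
  by rewrite /= in_itv/= -ler_pdivlMr// h1 -ltr_pdivrMr.
(* The other [e] is the rounding of [g] up to the next multiple of [e], integrated over an interval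
   of length 1. *)
apply: (@le_trans _ _ (\sum_(k <oo) (\int[mu]_(t in E k) (g t + e)%:E +
    (e / (2 ^ k.+1)%:R)%:E))).
  apply: lee_nneseries => [k _ _|k _].
    by rewrite mule_ge0// lee_fin mulr_ge0// ltW.
  have c0 : (0 < k.+1%:R * e)%R by rewrite mulr_gt0.
  apply: (@le_trans _ _ ((k.+1%:R * e)%:E * (mu (E k) + (eta k)%:E))).
    rewrite lee_pmul2l ?lte_fin//.
    have [_ EU UE] := hU k.
    apply: (@le_trans _ _ (mu (U k))).
      apply: le_measure; rewrite ?inE; last exact: subIsetl.
        by apply: measurableI; [exact: mU|exact: measurable_itv].
      exact: mU.
    have <- : E k `|` (U k `\` E k) = U k.
      exact: setDUK.
    apply: (@le_trans _ _ (mu (E k) + mu (U k `\` E k))).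
      by apply: measureU2; [exact: mE|apply: measurableD; [exact: mU|exact: mE]].
    by rewrite leeD2l// ltW.
  have etaE : (k.+1%:R * e * eta k = e / (2 ^ k.+1)%:R)%R.
    by rewrite mulrC divfK// gt_eqF.
  rewrite muleDr ?fin_num_adde_defl// -EFinM etaE leeD2r//.
  rewrite -(integral_cst mu (mE k)); apply: ge0_le_integral => //.
  - exact: mE.
  - by move=> t _; rewrite /= lee_fin ltW.
  - apply/measurable_EFinP; apply: measurable_funD => //.
    by apply: measurable_funS mg => //; exact: EI.
  - move=> t [_]; rewrite /= in_itv/= => /andP[h _].
    by rewrite lee_fin -natr1 mulrDl mul1r lerD2r.
rewrite nneseriesD; last 2 first.
- by move=> k _ _; apply: integral_ge0 => t _; rewrite lee_fin addr_ge0// ltW.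
- by move=> k _ _; rewrite lee_fin divr_ge0// ltW.
rewrite EFinD addeA leeD//; last by apply: epsilon_trick0; exact: ltW.
have UE : \bigcup_k E k = `[0%R, 1%R]%classic :> set R.
  apply/seteqP; split=> [t [k _ []]//|t t01]; exists (Num.truncn (g t / e)) => //.
  have ge0 : (0 <= g t / e)%R by rewrite divr_ge0// ltW.
  have /andP[h1 h2] := truncn_itv ge0.
  by split => //=; rewrite /= in_itv/= -ler_pdivlMr// h1 -ltr_pdivrMr.
rewrite -ge0_integral_bigcup//=; last 3 first.
- rewrite UE; apply/measurable_EFinP; exact: measurable_funD.
- by move=> t _; rewrite lee_fin addr_ge0// ltW.
- apply: ltn_trivIset => i j ij; apply/seteqP; split => // t [[_ /= h] [_ /= h']]; move: h h'.
  rewrite !in_itv/= => /andP[_ h1] /andP[h2 _].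
  have := le_lt_trans h2 h1; rewrite ltr_pM2r// ltr_nat ltnS leqNgt.
  by rewrite ij.
rewrite UE; under eq_integral do rewrite EFinD.
rewrite ge0_integralD//; last 3 first.
- by move=> t _; rewrite lee_fin.
- exact/measurable_EFinP.
- by move=> t _; rewrite lee_fin ltW.
by rewrite leeD2l// integral_cst//= mu1 mule1.
Qed.


(** Replaces the fundamental theorem of calculus. The segment is cut into small tagged intervals:
    around a tag where [f] has a derivative, the increment is charged to the majorant of [g]; the
    intervals tagged by the remaining null set have small total length, and absolute continuity
    bounds their increments together. *)
Lemma ac_increment_le (f : R -> 'rV[R]_d) (g : R -> R) :
  absolutely_continuous f ->
  @measurable_fun _ _ R R `[0%R, 1%R] g -> (forall t, 0 <= g t)%R ->
  {ae mu, forall t : R, t \in `]0%R, 1%R[ ->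
    exists2 D, is_derive t 1%R f D & (enorm D <= g t)%R} ->
  (enorm (f 1%R - f 0%R))%:E <= \int[mu]_(t in `[0%R, 1%R]) (g t)%:E.
Proof.
move=> acf mg g0 [N [mN N0 NE]]; apply/lee_addgt0Pr => e' e'0.
(* One third for the exceptional intervals, two for the error [e + e] of [local_majorant]. *)
pose e := (e' / 3)%R; have e0 : (0 < e)%R by rewrite divr_gt0.
have [U [oU Ut Us]] := local_majorant mg g0 e0.
have mU k : measurable (U k) by apply: open_measurable.
have [del del0 hac] := acf e e0.
(* The derivative is only known inside the open interval, so both endpoints join the exceptional
   times. *)
pose Z := N `|` ([set 0%R] `|` [set 1%R]).
have m01 : measurable ([set 0%R] `|` [set 1%R] : set R) by exact: measurableU.
have mu01 : mu ([set 0%R] `|` [set 1%R]) = 0.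
  by rewrite measureU0//=; exact: lebesgue_measure_set1.
have mZ : measurable Z by exact: measurableU.
have Z0 : mu Z = 0 by rewrite measureU0.
have Zoo : mu Z <= 0 by rewrite Z0.
have [V [oV ZV Vd]] : exists V, [/\ open V, Z `<=` V & mu (V `\` Z) < del%:E].
  by apply: lebesgue_regularity_outer => //; exact: le_lt_trans (ltry 0%R).
have mV : measurable V by exact: open_measurable.
have muV : mu V < del%:E.
  rewrite -(setDUK ZV); apply: (@le_lt_trans _ _ (mu Z + mu (V `\` Z))).
    by apply: measureU2 => //; exact: measurableD.
  by rewrite Z0 add0e.
pose nu x y := \sum_(k <oo) ((k.+1%:R * e)%:E * mu (U k `&` `]x, y])).
have nu_ge0 x y k : 0 <= (k.+1%:R * e)%:E * mu (U k `&` `]x, y]).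
  by rewrite mule_ge0// lee_fin mulr_ge0// ltW.
(* [s] lists, from left to right, the intervals tagged by exceptional times; [nu] pays for the
   others. Half-open intervals make [nu] and the measure of [V] additive under concatenation. *)
pose P x y := exists s : seq (R * R), [/\
  all (fun p => (x <= p.1) && (p.1 <= p.2) && (p.2 <= y))%R s,
  pairwise (fun p q => p.2 <= q.1)%R s,
  (\sum_(p <- s) (p.2 - p.1))%:E <= mu (V `&` `]x, y]) &
  (enorm (f y - f x))%:E <= (\sum_(p <- s) enorm (f p.2 - f p.1))%:E + nu x y].
have [s [s01 spw sV sf]] : P 0%R 1%R.
  apply: cousin_induction => //.
    move=> x y z _ xy yz _ [s1 [a1 p1 v1 f1]] [s2 [a2 p2 v2 f2]].
    exists (s1 ++ s2); split.
    - rewrite all_cat; apply/andP; split.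
        apply: sub_all a1 => p /andP[/andP[-> ->]] /= h.
        exact: le_trans yz.
      by apply: sub_all a2 => p /andP[/andP[h -> ->]]; rewrite (le_trans xy).
    - rewrite pairwise_cat p1 p2 !andbT; apply/allrelP => p q.
      move=> /(allP a1)/andP[_ h1] /(allP a2)/andP[/andP[h2 _] _].
      exact: le_trans h2.
    - by rewrite big_cat/= EFinD (measure_open_itvocD mV xy yz) leeD.
    - rewrite big_cat/= EFinD.
      have -> : nu x z = nu x y + nu y z.
        rewrite /nu -nneseriesD//; apply: eq_eseriesr => k _.
        by rewrite (measure_open_itvocD (mU k) xy yz) ge0_muleDr.
      rewrite addeACA; apply: le_trans (leeD f1 f2).
      rewrite -EFinD lee_fin; apply: le_trans (ler_enormD _ _).
      by rewrite [(f y - f x + _)%R]addrC addrA subrK.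
  (* Around an exceptional time the whole interval goes into [s], and lies in [V]. *)
  move=> t t0 t1; have [Zt|nZt] := pselect (Z t).
    have [del' /= del'0 tV] : nbhs_ball t V.
      by apply/nbhs_ballP; rewrite openE in oV; exact/oV/ZV.
    exists del' => // x y x0 xt ty y1 tx yt.
    exists [:: (x, y)]; split => //=.
    - by rewrite lexx (le_trans xt ty) lexx.
    - rewrite big_seq1/=.
      have -> : V `&` `]x, y] = `]x, y]%classic :> set R.
        apply: setIidr => z /=; rewrite in_itv/= => /andP[xz zy]; apply: tV.
        by rewrite /ball/= ltr_distlC; apply/andP; split; lra.
      by rewrite lebesgue_measure_itv/= lte_fin; case: ifPn => //; rewrite -leNgt lee_fin subr_le0.
    - by rewrite big_seq1/= leeDl// nneseries_ge0.
  have t01 : (0 < t < 1)%R.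
    rewrite !lt_neqAle t0 t1 !andbT; apply/andP; split; apply/eqP => tE; apply: nZt.
      by right; left; rewrite /= -tE.
    by right; right; rewrite /= tE.
  have [D fD Dg] : exists2 D, is_derive t 1%R f D & (enorm D <= g t)%R.
    apply: contrapT => H; apply: nZt; left; apply: NE => /= K; apply: H.
    by apply: K; rewrite in_itv.
  have [k Ukt gk] : exists2 k, U k t & (g t < k.+1%:R * e)%R.
    by apply: Ut; rewrite t0 t1.
  have [del' /= del'0 tU] : nbhs_ball t (U k `&`
      [set s | enorm (f s - f t) <= k.+1%:R * e * `|s - t|]%R).
    apply/nbhs_ballP; apply: filterI.
      by have := oU k; rewrite openE; exact.
    by apply: is_derive_enorm_lt fD _; exact: le_lt_trans gk.
  exists del' => // x y x0 xt ty y1 tx yt.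
  have inU z : (x <= z <= y)%R -> (U k `&`
      [set s | enorm (f s - f t) <= k.+1%:R * e * `|s - t|]%R) z.
    move=> /andP[xz zy]; apply: tU.
    by rewrite /ball/= ltr_distlC; apply/andP; split; lra.
  (* Around a good time nothing is listed: the interval lies in [U k], so the [k]-th term of [nu]
     alone dominates the increment, which is split at the tag [t]. *)
  exists [::]; split => //=; first by rewrite big_nil.
  rewrite big_nil add0e.
  apply: (@le_trans _ _ ((k.+1%:R * e)%:E * mu (U k `&` `]x, y]))); last first.
    by rewrite /nu (@nneseriesD1 _ _ k)// leeDl// nneseries_ge0.
  have -> : U k `&` `]x, y] = `]x, y]%classic :> set R.
    apply: setIidr => z /=; rewrite in_itv/= => /andP[xz zy].
    by apply: (inU z _).1; rewrite ltW.
  have -> : mu `]x, y] = (y - x)%:E.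
    rewrite lebesgue_measure_itv/= lte_fin; case: ifPn => //; rewrite -leNgt => yx.
    by congr EFin; apply/esym/eqP; rewrite subr_eq0 eq_le yx (le_trans xt ty).
  rewrite -EFinM lee_fin.
  have [_ /= hx] : (U k `&`
      [set s | enorm (f s - f t) <= k.+1%:R * e * `|s - t|]%R) x.
    by apply: inU; rewrite lexx (le_trans xt ty).
  have [_ /= hy] : (U k `&`
      [set s | enorm (f s - f t) <= k.+1%:R * e * `|s - t|]%R) y.
    by apply: inU; rewrite lexx (le_trans xt ty).
  rewrite distrC ger0_norm ?subr_ge0// in hx.
  rewrite ger0_norm ?subr_ge0// in hy.
  rewrite -(subrK (f t) (f y)) -addrA; apply: le_trans (ler_enormD _ _) _.
  rewrite (enormB (f t)); apply: le_trans (lerD hy hx) _.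
  by rewrite -mulrDr addrA subrK.
(* The order of [s] makes its open intervals disjoint, and [V] bounds their total length by
   [del]. *)
have small : (\sum_(p <- s) enorm (f p.2 - f p.1) < e)%R.
  pose a (i : 'I_(size s)) := (nth (0%R, 0%R) s i).1.
  pose b (i : 'I_(size s)) := (nth (0%R, 0%R) s i).2.
  rewrite (big_nth (0%R, 0%R)) big_mkord; apply: (hac _ a b).
  - move=> i; have /andP[/andP[? ?] ?] := allP s01 _ (mem_nth (0%R, 0%R) (ltn_ord i)).
    by split.
  - have disj (i j : 'I_(size s)) (t : R) : (i < j)%N -> (`]a i, b i[%classic : set R) t ->
        ~ (`]a j, b j[%classic : set R) t.
      move=> ij; rewrite /= !in_itv/= => /andP[_ tb] /andP[at' _].
      have /(pairwiseP (0%R, 0%R)) := spw.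
      move=> /(_ i j (ltn_ord i) (ltn_ord j) ij) bi.
      by have := lt_trans (lt_le_trans tb bi) at'; rewrite ltxx.
    move=> i j _ _ [t [ti tj]]; apply/val_inj/eqP/negPn/negP.
    rewrite neq_ltn => /orP[ij|ji]; first exact: disj ij ti tj.
    exact: disj ji tj ti.
  - rewrite -lte_fin; apply: le_lt_trans muV.
    move: sV; rewrite (big_nth (0%R, 0%R)) big_mkord => /le_trans; apply.
    by apply: le_measure; rewrite ?inE//; exact: measurableI.
apply: (le_trans sf).
 apply: (@le_trans _ _ (e%:E + (\int[mu]_(t in `[0%R, 1%R]) (g t)%:E + (e + e)%:E))).
  by apply: leeD => //; rewrite lee_fin ltW.
rewrite addeCA leeD2l// -EFinD lee_fin /e; lra.
Qed.

End AbsolutelyContinuousIncrement.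

(** * Curves and compactly supported tests *)

Section CurveEvaluation.
Variables (R : realType) (d : nat).
Import ArrowAsUniformType.

(** Functions uniformly close to [l] are close to it at [x]; curves carry the initial topology, so
    continuity on the space of all functions is enough. *)
Lemma curve_eval_continuous (x : (`[0, 1]%classic : set R)) :
  continuous (fun l : curve R d => (l : _ -> 'rV[R]_d) x).
Proof.
move=> l; apply: (@continuous_comp (curve R d)
  ((`[0, 1]%classic : set R) -> 'rV[R]_d) _ (fun l => (l : _ -> _))
  (fun g => g x)).
  exact: initial_continuous.
move=> A; rewrite /= -filter_from_entourageE => -[E entE EA].
change (nbhs (l : arrow_uniform_type (`[0, 1]%classic : set R) 'rV[R]_d)
  [set g | A (g x)]).
rewrite -filter_from_entourageE.
exists [set fg | forall t, E (fg.1 t, fg.2 t)]; first by exists E.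
by move=> g /xsectionP /= h; apply: EA; apply/xsectionP; exact: h.
Qed.

Lemma curve_atE (l : curve R d) (t : R) (t01 : t \in (`[0, 1]%classic : set R)) :
  curve_at l t = (l : _ -> 'rV[R]_d) (SigSub t01).
Proof. by rewrite /curve_at /valL_/= oinv_set_val insubT. Qed.

Lemma curve_at_out (l : curve R d) (t : R) :
  t \notin (`[0, 1]%classic : set R) -> curve_at l t = 0.
Proof. by move=> t01; rewrite /curve_at /valL_/= oinv_set_val insubN. Qed.

Lemma measurable_curve_at (t : R) :
  measurable_fun setT (fun l : curve R d => curve_at l t).
Proof.
have [t01|t01] := boolP (t \in (`[0, 1]%classic : set R)); last first.
  by under eq_fun do rewrite curve_at_out//; exact: measurable_cst.
under eq_fun do rewrite (curve_atE _ t01).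
apply: measurable_fun_rVP => // i; apply: measurable_fun_open_preimage => V oV.
apply: sub_sigma_algebra; apply: open_comp oV => l _.
apply: (@continuous_comp (curve R d) 'rV[R]_d R _ (fun v => v ord0 i)).
  exact: curve_eval_continuous.
exact: coord_continuous.
Qed.

Lemma curve_at_continuous (l : curve R d) :
  {within (`[0, 1]%classic : set R), continuous (curve_at l)}.
Proof.
by apply/subspace_valL_continuousP'; exact: (@cts_fun _ _ l).
Qed.

(* A curve is the pointwise limit of its right-continuous step interpolations,
   which are jointly measurable. *)
Let measurable_curve_at_cylinder :
  @measurable_fun _ _ (R * curve R d)%type 'rV[R]_d (`[0, 1] `*` setT)
    (fun tl => curve_at tl.2 tl.1).
Proof.
have mD : measurable (`[0%R, 1%R]%classic `*` [set: curve R d] :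
    set (R * curve R d)) by exact: measurableX.
apply: measurable_fun_rVP => // i.
pose B n k : set R := `[k%:R / n.+1%:R, k.+1%:R / n.+1%:R[%classic.
(* There are [n.+2] cells because the time 1 belongs to the cell of index [n.+1]. *)
pose h n (tl : R * curve R d) : R := \sum_(k < n.+2)
  \1_(B n k) tl.1 * (curve_at tl.2 (k%:R / n.+1%:R)) ord0 i.
have hE n (tl : R * curve R d) : 0 <= tl.1 <= 1 ->
    h n tl = (curve_at tl.2 ((Num.truncn (tl.1 * n.+1%:R))%:R / n.+1%:R)) ord0 i.
  move=> /andP[t0 t1]; set m := Num.truncn _.
  have /andP[m1 m2] : m%:R <= tl.1 * n.+1%:R < m.+1%:R.
    by apply: truncn_itv; rewrite mulr_ge0.
  have mn : (m < n.+2)%N.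
    rewrite ltnS -(ler_nat R); apply: le_trans m1 _.
    by rewrite ler_piMl.
  rewrite /h (bigD1 (Ordinal mn))//= big1 ?addr0.
    rewrite indicE mem_set ?mul1r// /B /= in_itv/=.
    by rewrite ler_pdivrMr// m1 ltr_pdivlMr.
  move=> k km; rewrite indicE memNset ?mul0r// /B /= in_itv/=.
  rewrite ler_pdivrMr// ltr_pdivlMr// => /andP[k1 k2].
  move/negP: km; apply; apply/eqP/val_inj/eqP => /=.
  rewrite eqn_leq; apply/andP; split.
    by rewrite -ltnS -(ltr_nat R); exact: le_lt_trans m2.
  by rewrite -ltnS -(ltr_nat R); exact: le_lt_trans k2.
apply: (measurable_fun_cvg (h := h)) => //.
  move=> n; apply: measurable_sum => k; apply: measurable_funM.
    apply: (measurable_funS measurableT) => //.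
    have mB : measurable_fun setT (\1_(B n k) : R -> R).
      by apply/measurable_indicP; exact: measurable_itv.
    exact: (measurableT_comp mB measurable_fst).
  apply: (measurable_funS measurableT) => //.
  apply: measurable_fun_coord.
  exact: (measurableT_comp (measurable_curve_at _) measurable_snd).
move=> [t l] [/=]; rewrite in_itv/= => /andP[t0 t1] _.
under eq_fun do rewrite hE ?t0//=.
(* Rounding down keeps the nodes inside the unit interval, the only place where [curve_at l] is
   continuous. *)
pose q n : R := (Num.truncn (t * n.+1%:R))%:R / n.+1%:R.
have q01 n : (`[0, 1]%classic : set R) (q n).
  rewrite /= in_itv/= divr_ge0//= ler_pdivrMr// mul1r.
  have /andP[h1 h2] : (Num.truncn (t * n.+1%:R))%:R <= t * n.+1%:R <
      (Num.truncn (t * n.+1%:R)).+1%:R.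
    by apply: truncn_itv; rewrite mulr_ge0.
  by apply: le_trans h1 _; rewrite ler_piMl.
have qt : q n @[n --> \oo] --> t.
  apply/cvgrPdist_lt => e e0; near=> n.
  have /andP[h1 h2] : (Num.truncn (t * n.+1%:R))%:R <= t * n.+1%:R <
      (Num.truncn (t * n.+1%:R)).+1%:R.
    by apply: truncn_itv; rewrite mulr_ge0.
  have qt : q n <= t by rewrite ler_pdivrMr.
  rewrite ger0_norm ?subr_ge0//.
  apply: (@le_lt_trans _ _ n.+1%:R^-1).
    rewrite lerBlDr -[X in X + _]mul1r -mulrDl ler_pdivlMr//.
    by rewrite nat1r ltW.
  by near: n; exact: near_infty_natSinv_lt (PosNum e0).
have : curve_at l (q n) @[n --> \oo] --> curve_at l t.
  have := (subspace_continuousP _ (curve_at l)).1 (@curve_at_continuous l) t.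
  rewrite /= in_itv/= t0 t1 => /(_ isT); apply: cvg_trans.
  apply: (@cvg_comp _ _ _ q (curve_at l) _ (within `[0, 1]%classic (nbhs t))).
    move=> A /=; rewrite /within/= => nA.
    have := qt _ nA; rewrite /nbhs/=; apply: filterS => n; apply; exact: q01.
  by move=> A.
move=> cl; apply: (@cvg_comp _ _ _ _ (fun v : 'rV[R]_d => v ord0 i) _ _ _ cl).
exact: coord_continuous.
Unshelve. all: by end_near. Qed.

(** [curve_at] vanishes off the unit interval, so it is its own extension by 0 from the cylinder. *)
Lemma measurable_curve_at_pair :
  @measurable_fun _ _ (R * curve R d)%type 'rV[R]_d setT
    (fun tl => curve_at tl.2 tl.1).
Proof.
have mD : measurable (`[0%R, 1%R]%classic `*` [set: curve R d] :
    set (R * curve R d)) by exact: measurableX.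
apply: measurable_fun_rVP => // i.
have := measurable_fun_coord i measurable_curve_at_cylinder.
move=> /(measurable_restrictT _ mD).1; congr (measurable_fun _ _).
apply/funext => -[t l]; rewrite /patch; case: ifPn => //= /negP tD.
rewrite curve_at_out ?mxE//; apply/negP => /set_mem t01; apply: tD.
by rewrite inE.
Qed.

End CurveEvaluation.

Lemma continuous_minr (T : topologicalType) (R : realType) (f g : T -> R) :
  continuous f -> continuous g -> continuous (fun x => Num.min (f x) (g x)).
Proof. by move=> cf cg x; exact: (continuous_min (cf x) (cg x)). Qed.

Lemma continuous_maxr (T : topologicalType) (R : realType) (f g : T -> R) :
  continuous f -> continuous g -> continuous (fun x => Num.max (f x) (g x)).
Proof. by move=> cf cg x; exact: (continuous_max (cf x) (cg x)). Qed.

(** * Compactly supported tests determine a finite measure *)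

Section CompactlySupportedTests.
Variables (R : realType) (d : nat).
Local Notation Rd := 'rV[R]_d.

Lemma bounded_compact_closure (k : R) (S : set Rd) :
  (forall x, S x -> enorm x <= k) -> compact (closure S).
Proof.
move=> Sk.
pose B := [set v : Rd | forall i, (`[- k, k]%classic : set R) (v ord0 i)].
have cB : compact B.
  apply: (@rV_compact R d (fun=> `[- k, k]%classic)) => i.
  exact: segment_compact.
apply: (subclosed_compact _ cB); first exact: closed_closure.
have /closure_id -> : closed B by apply: compact_closed cB; exact: norm_hausdorff.
apply: closure_subset => x Sx i; rewrite /= in_itv/= -ler_norml.
by apply: le_trans (Sk x Sx); exact: coord_le_enorm.
Qed.

Lemma open_is_positivity_set (U : set Rd) : open U -> exists phi : Rd -> R,
  [/\ continuous phi, forall x, 0 <= phi x & forall x, U x <-> 0 < phi x].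
Proof.
move=> oU.
(* [inf (S x)] is the distance to the complement of [U], truncated at 1; the element 1 keeps [S x]
   nonempty when [U] is the whole space. It is 1-Lipschitz in [x]. *)
pose S x := [set r | r = 1 \/ exists2 y, ~ U y & r = `|x - y|].
have S0 x : lbound (S x) 0 by move=> r [->//|[y _ ->]].
have hS x : has_inf (S x) by split; [exists 1; left|exists 0].
have lip x z : inf (S x) <= inf (S z) + `|x - z|.
  rewrite -lerBlDr; apply: lb_le_inf; first exact: (hS z).1.
  move=> r [->|[y nUy ->]]; rewrite lerBlDr.
    apply: (@le_trans _ _ 1); last by rewrite lerDl.
    by apply: ge_inf; [exact: (hS x).2|left].
  apply: (@le_trans _ _ `|x - y|).
    by apply: ge_inf; [exact: (hS x).2|right; exists y].
  by rewrite -(subrK z x) -addrA addrC; apply: (le_trans (ler_normD _ _)); rewrite subrK.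
exists (fun x => inf (S x)); split.
- move=> x; apply/(@cvgrPdist_lt _ _ _ (nbhs x)) => e e0; near=> z.
  apply: (@le_lt_trans _ _ `|x - z|).
    have := lip x z; have := lip z x; rewrite (distrC z) => h1 h2.
    by rewrite ler_norml; apply/andP; split; lra.
  by near: z; apply: cvgr_dist_lt.
- by move=> x; apply: lb_le_inf; [exact: (hS x).1|exact: S0].
- move=> x; split=> [Ux|]; last first.
    move=> x0; apply: contrapT => nUx; have : inf (S x) <= `|x - x|.
      by apply: ge_inf; [exact: (hS x).2|right; exists x].
    by rewrite subrr normr0 leNgt x0.
  have [e /= e0 xeU] : nbhs_ball x U.
    by apply/nbhs_ballP; rewrite openE in oU; exact: oU.
  apply: (@lt_le_trans _ _ (Num.min 1 e)); first by rewrite lt_min ltr01.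
  apply: lb_le_inf; first exact: (hS x).1.
  move=> r [->|[y nUy ->]]; first by rewrite ge_min lexx.
  rewrite ge_min; apply/orP; right; rewrite leNgt; apply/negP => xye.
  by apply: nUy; apply: xeU; rewrite -ball_normE.
Unshelve. all: by end_near. Qed.

(** The indicator of an open set is an increasing limit of test functions, so the measures agree on
    open sets, which are stable under intersection and generate the Borel sets. *)
Lemma Cc_measure_unique (m1 m2 : {measure set Rd -> \bar R}) :
  (m1 setT < +oo)%E ->
  (forall psi : Rd -> R, continuous psi -> compactly_supported psi ->
    (forall x, 0 <= psi x) -> (\int[m1]_x (psi x)%:E = \int[m2]_x (psi x)%:E)%E) ->
  forall A, measurable A -> m1 A = m2 A.
Proof.
move=> m1T H.
have HU U : open U -> m1 U = m2 U.
  move=> oU; have [phi [cphi phi0 phiU]] := open_is_positivity_set oU.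
  (* The first factor increases to the indicator of [U]; the second increases to 1 and vanishes
     outside the ball of radius [k]. *)
  pose psi (k : nat) x := Num.min 1 (k%:R * phi x) * Num.max 0 (Num.min 1 (k%:R - enorm x)).
  have cpsi k : continuous (psi k).
    have c1 : continuous (fun x => k%:R * phi x).
      move=> x; apply: (@continuous_comp _ _ _ phi (fun y => k%:R * y)).
        exact: cphi.
      exact: mulrl_continuous.
    have c2 : continuous (fun x : Rd => k%:R - enorm x).
      move=> x; apply: (@continuous_comp Rd R R (@enorm R d) (fun y : R => k%:R - y)).
        exact: enorm_continuous.
      by apply: cvgB; [exact: cvg_cst|exact: cvg_id].
    have c3 (a : R) : continuous (fun _ : Rd => a) by move=> x; exact: cst_continuous.
    move=> x; apply: (@cvgM _ _ (nbhs x)).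
      exact: (continuous_minr (c3 1) c1).
    exact: (continuous_maxr (c3 0) (continuous_minr (c3 1) c2)).
  have a0 k x : 0 <= Num.min 1 (k%:R * phi x) by rewrite le_min ler01 mulr_ge0.
  have b0 k x : 0 <= Num.max 0 (Num.min 1 (k%:R - enorm x)) by rewrite le_max lexx.
  have psi0 k x : 0 <= psi k x by rewrite mulr_ge0.
  have spsi k : compactly_supported (psi k).
    apply: (@bounded_compact_closure k%:R) => x /=; rewrite leNgt; apply: contraNN => kx.
    rewrite /psi (_ : Num.max _ _ = 0) ?mulr0//; apply/max_idPl.
    by rewrite ge_min subr_le0 (ltW kx) orbT.
  have ndpsi x : {homo (fun k => psi k x) : m n / (m <= n)%N >-> m <= n}.
    move=> m n mn; apply: ler_pM => //.
      by rewrite le_min !ge_min lexx/=; apply/orP; right; rewrite ler_wpM2r// ler_nat.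
    rewrite ge_max le_max lexx/= le_max; apply/orP; right.
    rewrite le_min !ge_min lexx/=; apply/orP; right.
    by rewrite lerD2r ler_nat.
  have cvgpsi x : (psi k x)%:E @[k --> \oo] --> (\1_U x)%:E.
    apply: cvg_EFin; first by apply: nearW.
    apply: (@cvg_near_cst _ _ _ _ _ _).
    have [Ux|nUx] := pselect (U x); last first.
      apply: nearW => k; rewrite indicE memNset// /psi.
      have /eqP -> : phi x == 0.
        by rewrite eq_le phi0 andbT leNgt; apply/negP => /phiU.
      by rewrite /= mulr0 (min_idPr ler01) mul0r.
    near=> k; rewrite /= indicE mem_set//= /psi.
    rewrite (min_idPl _); last first.
      rewrite -ler_pdivrMr ?(phiU x).1//; near: k; exact: nbhs_infty_ger.
    rewrite mul1r (min_idPl _) ?(max_idPr ler01)//.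
    rewrite lerBrDr; near: k; exact: nbhs_infty_ger.
  have mpsi k : measurable_fun setT (fun x => (psi k x)%:E).
    by apply/measurable_EFinP; apply: continuous_measurable_rV; exact: cpsi.
  have mcv (m : {measure set Rd -> \bar R}) :
      (\int[m]_x (psi k x)%:E)%E @[k --> \oo] --> m U.
    have := @cvg_monotone_convergence _ _ _ m setT measurableT
      (fun k x => (psi k x)%:E) mpsi _ _.
    rewrite (_ : \int[m]_x _ = m U)%E; last first.
      transitivity (\int[m]_x (\1_U x)%:E)%E.
        by apply: eq_integral => x _; apply/cvg_lim => //; exact: cvgpsi.
      by rewrite integral_indic ?setIT//; exact: open_measurable_rV.
    apply.
      by move=> n x _; rewrite lee_fin.
    by move=> x _ m' n mn; rewrite lee_fin; exact: ndpsi.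
  apply: (cvg_unique _ (mcv m1)) => //.
  rewrite /= (_ : (fun k => _) = fun k => (\int[m2]_x (psi k x)%:E)%E).
    exact: mcv.
  by apply/funext => k; exact: H.
move=> A mA; apply: (measure_unique (@open Rd) (fun=> setT)) => //.
- by move=> U V; exact: openI.
- by move=> _; exact: openT.
- by rewrite bigcup_const.
Unshelve. all: by end_near. Qed.

End CompactlySupportedTests.

(** * Energy of the velocity field *)

Section PushforwardIntegral.
Context d1 d2 (X : measurableType d1) (Y : measurableType d2) (R : realType).

Lemma ge0_integral_pushforwardT (phi : X -> Y) (m : {measure set X -> \bar R})
    (f : Y -> \bar R) :
  measurable_fun setT phi -> measurable_fun setT f -> (forall y, 0 <= f y)%E ->
  (\int[pushforward m phi]_y f y = \int[m]_x f (phi x))%E.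
Proof.
by move=> mphi mf f0; rewrite ge0_integral_pushforward.
Qed.

End PushforwardIntegral.

(** Carries the marginal condition from continuous tests to [|v_t|^2], which is only Borel. *)
Lemma Cc_law_unique (R : realType) (d : nat) d1 d2 (T1 : measurableType d1)
    (T2 : measurableType d2) (P1 : probability T1 R) (P2 : probability T2 R)
    (f1 : T1 -> 'rV[R]_d) (f2 : T2 -> 'rV[R]_d) :
  measurable_fun setT f1 -> measurable_fun setT f2 ->
  (forall psi : 'rV[R]_d -> R, continuous psi -> compactly_supported psi ->
    (forall x, 0 <= psi x) ->
    (\int[P1]_x (psi (f1 x))%:E = \int[P2]_x (psi (f2 x))%:E)%E) ->
  forall h : 'rV[R]_d -> \bar R, measurable_fun setT h -> (forall x, 0 <= h x)%E ->
    (\int[P1]_x h (f1 x) = \int[P2]_x h (f2 x))%E.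
Proof.
move=> mf1 mf2 H h mh h0.
rewrite -(ge0_integral_pushforwardT P1 mf1 mh h0).
rewrite -(ge0_integral_pushforwardT P2 mf2 mh h0).
apply: eq_measure_integral => A mA _.
apply: Cc_measure_unique => //.
  change (P1 (f1 @^-1` setT) < +oo)%E; rewrite preimage_setT.
  by apply: le_lt_trans (ltry 1); exact: probability_le1.
move=> psi cpsi spsi psi0.
have mpsi : measurable_fun setT (fun x => (psi x)%:E).
  by apply/measurable_EFinP; exact: continuous_measurable_rV.
by rewrite !ge0_integral_pushforwardT//; exact: H.
Qed.

(** * Tonelli's theorem over the unit time interval *)

Section UnitTimeIntegral.
Local Open Scope ereal_scope.
Context d' (Y : measurableType d') (R : realType) (m : probability Y R).
Local Notation mu := (@lebesgue_measure R).
Local Notation D := (`[0%R, 1%R]%classic `*` [set: Y] : set (R * Y)).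

Lemma measurable_unit_cylinder : measurable D.
Proof. exact: measurableX. Qed.

Lemma measurable_time_section d'' (Z : measurableType d'') (F : R * Y -> Z) y :
  measurable_fun D F -> @measurable_fun _ _ R Z `[0%R, 1%R] (fun t => F (t, y)).
Proof.
move=> mF; apply: (measurable_comp (F := D)) mF _ => //.
- exact: measurable_unit_cylinder.
- by move=> _ [t t01 <-].
- by apply: measurable_funTS; apply: measurable_fun_pair.
Qed.

Lemma measurable_space_section d'' (Z : measurableType d'') (F : R * Y -> Z) t :
  measurable_fun D F -> (0 <= t <= 1)%R -> measurable_fun setT (fun y => F (t, y)).
Proof.
move=> mF t01; apply: (measurable_comp (F := D)) mF _ => //.
- exact: measurable_unit_cylinder.
- by move=> _ [y _ <-]; split => //=; rewrite in_itv.
Qed.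

Variable F : R * Y -> \bar R.
Hypotheses (mF : measurable_fun D F) (F0 : forall z, 0 <= F z).

(** Velocity fields are measurable on the cylinder over the unit interval only, so Tonelli is
    applied to the extension by 0. *)
Let mFD : measurable_fun setT (F \_ D).
Proof. by apply: (measurable_restrictT F measurable_unit_cylinder).1. Qed.

Let FD0 z : 0 <= (F \_ D) z. Proof. exact: erestrict_ge0. Qed.

Lemma integral_time_first :
  \int[mu]_(t in `[0%R, 1%R]) \int[m]_y F (t, y) = \int[mu \x m]_(z in D) F z.
Proof.
rewrite [RHS]integral_mkcond fubini_tonelli1//; rewrite [LHS]integral_mkcond.
apply: eq_integral => t _; rewrite /fubini_F/= /patch.
case: ifPn => [/set_mem t01|/negP t01].
  by apply: eq_integral => y _; rewrite mem_set.
rewrite integral0_eq// => y _; rewrite memNset// => -[/= H _].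
by apply: t01; rewrite inE.
Qed.

Lemma integral_space_first :
  \int[m]_y \int[mu]_(t in `[0%R, 1%R]) F (t, y) = \int[mu \x m]_(z in D) F z.
Proof.
rewrite [RHS]integral_mkcond fubini_tonelli2//.
apply: eq_integral => y _; rewrite /fubini_G/= integral_mkcond.
apply: eq_integral => t _; rewrite /patch.
case: ifPn => [/set_mem t01|/negP t01].
  by rewrite mem_set.
rewrite memNset// => -[/= H _].
by apply: t01; rewrite inE.
Qed.

Lemma measurable_time_integral :
  measurable_fun setT (fun y => \int[mu]_(t in `[0%R, 1%R]) F (t, y)).
Proof.
rewrite (_ : (fun y => _) = fubini_G mu (F \_ D)).
  by apply: measurable_fun_fubini_tonelli_G.
apply/funext => y; rewrite /fubini_G/= integral_mkcond.
apply: eq_integral => t _; rewrite /patch.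
case: ifPn => [/set_mem t01|/negP t01].
  by rewrite mem_set.
rewrite memNset// => -[/= H _].
by apply: t01; rewrite inE.
Qed.

End UnitTimeIntegral.

Section Energy.
Local Open Scope ereal_scope.
Variables (R : realType) (d : nat).
Local Notation Rd := 'rV[R]_d.
Local Notation X := (Rd * Rd)%type.
Local Notation mu := (@lebesgue_measure R).

Definition transport_cost (P : probability X R) : \bar R :=
  \int[P]_p (enorm (p.1 - p.2) ^+ 2)%:E.

Lemma measurable_interp_pair :
  @measurable_fun _ _ (R * X)%type Rd setT (fun tp => interp tp.1 tp.2).
Proof.
apply: measurable_fun_rVD => //; apply: measurable_fun_rVZ => //.
- by apply: measurable_funB => //; exact: measurable_cst.
- exact: (measurableT_comp measurable_fst measurable_snd).
- exact: (measurableT_comp measurable_snd measurable_snd).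
Qed.

Lemma measurable_interp (t : R) : measurable_fun setT (@interp R d t).
Proof.
have := measurableT_comp measurable_interp_pair
  (measurable_fun_pair (measurable_cst t) (@measurable_id _ X setT)).
exact.
Qed.

Lemma measurable_transport_integrand :
  measurable_fun setT (fun p : X => (enorm (p.1 - p.2) ^+ 2)%:E).
Proof.
apply/measurable_EFinP; apply: measurable_funX; apply: measurable_fun_enorm.
exact: measurable_fun_rVB.
Qed.

(** Serves both for the interpolation of a pair of points and for the evaluation of a curve. *)
Lemma field_along_measurable d' (Y : measurableType d') (w : R -> Rd -> Rd)
    (e : R * Y -> Rd) :
  @measurable_fun _ _ (R * Rd)%type Rd (`[0%R, 1%R] `*` setT)
    (fun tx => w tx.1 tx.2) ->
  measurable_fun setT e ->
  @measurable_fun _ _ (R * Y)%type Rd (`[0%R, 1%R] `*` setT)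
    (fun ty => w ty.1 (e ty)).
Proof.
move=> mw me.
apply: (measurable_comp (g := fun ty : R * Y => (ty.1, e ty))) mw _.
- exact: measurable_unit_cylinder.
- by move=> _ [[t y] [t01 _] <-].
- by apply: measurable_funTS; apply: measurable_fun_pair.
Qed.

Lemma field_energyE (gamma : probability X R) (w : R -> Rd -> Rd) :
  @measurable_fun _ _ (R * Rd)%type Rd (`[0%R, 1%R] `*` setT)
    (fun tx => w tx.1 tx.2) ->
  \int[mu]_(t in `[0%R, 1%R])
     \int[interpolation gamma t]_x (enorm (w t x) ^+ 2)%:E =
  \int[mu \x gamma]_(z in `[0%R, 1%R] `*` setT)
     (enorm (w z.1 (interp z.1 z.2)) ^+ 2)%:E.
Proof.
move=> mw; rewrite -integral_time_first/=.
- apply: eq_integral => t; rewrite inE/= in_itv/= => t01.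
  rewrite /interpolation ge0_integral_pushforwardT//.
  + exact: measurable_interp.
  + apply/measurable_EFinP/measurable_funX/measurable_fun_enorm.
    exact: (measurable_space_section mw t01).
  + by move=> y; rewrite lee_fin sqr_ge0.
- apply/measurable_EFinP/measurable_funX/measurable_fun_enorm.
  exact: (field_along_measurable mw measurable_interp_pair).
- by move=> z; rewrite lee_fin sqr_ge0.
Qed.

(* With [u = y - x], [|s v - u|^2 = s |v - u|^2 + (1 - s) |u|^2 - s (1 - s) |v|^2],
   so comparing the minimizer [v] with [s v] and letting [s] tend to 1 gives
   [loss v + energy v <= cost]. *)
Lemma velocity_energy_le (gamma : probability X R) (v : R -> Rd -> Rd) :
  transport_cost gamma < +oo -> velocity_field gamma v ->
  \int[mu]_(t in `[0%R, 1%R])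
     \int[interpolation gamma t]_x (enorm (v t x) ^+ 2)%:E <=
  transport_cost gamma.
Proof.
move=> cfin [[mv vfin] vmin]; move: (vfin).
pose D : set (R * X) := `[0%R, 1%R] `*` setT.
have mD : measurable D by exact: measurable_unit_cylinder.
pose V (z : R * X) := v z.1 (interp z.1 z.2).
pose u (z : R * X) : Rd := (z.2.2 - z.2.1)%R.
have mV : measurable_fun D V by exact: (field_along_measurable mv measurable_interp_pair).
have mu' : measurable_fun setT u.
  apply: measurable_fun_rVB => //.
    exact: (measurableT_comp measurable_snd measurable_snd).
  exact: (measurableT_comp measurable_fst measurable_snd).
have mu_ : measurable_fun D u by exact: measurable_funTS.
pose I (F : R * X -> Rd) := \int[mu \x gamma]_(z in D) (enorm (F z) ^+ 2)%:E.
have I0 F : 0 <= I F by apply: integral_ge0 => z _; rewrite lee_fin sqr_ge0.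
have mI F : measurable_fun D F -> measurable_fun D (fun z => (enorm (F z) ^+ 2)%:E).
  by move=> mF; apply/measurable_EFinP/measurable_funX/measurable_fun_enorm.
rewrite field_energyE//; change (I V < +oo -> I V <= transport_cost gamma) => Efin.
have lossE (w : R -> Rd -> Rd) :
    @measurable_fun _ _ (R * Rd)%type Rd (`[0%R, 1%R] `*` setT)
      (fun tx => w tx.1 tx.2) ->
    flow_matching_loss gamma w = I (fun z => w z.1 (interp z.1 z.2) - u z)%R.
  move=> mw; rewrite /I -integral_time_first/=.
  - apply: eq_integral => t _; apply: eq_integral => p _.
    by rewrite /u/= opprB addrA addrAC.
  - apply: mI; apply: measurable_fun_rVB => //.
    exact: (field_along_measurable mw measurable_interp_pair).
  - by move=> z; rewrite lee_fin sqr_ge0.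
have costE : I u = transport_cost gamma.
  rewrite /I -integral_space_first/=.
  - apply: eq_integral => p _; transitivity (\int[mu]_(t in `[0%R, 1%R])
        cst (enorm (p.1 - p.2)%R ^+ 2)%:E t).
      by apply: eq_integral => t _; rewrite /u/= enormB.
    rewrite integral_cst//= lebesgue_measure_itv/=.
    by rewrite lte_fin ltr01 oppr0 adde0 mule1.
  - exact: mI.
  - by move=> z; rewrite lee_fin sqr_ge0.
pose sv (s : R) t x := s *: v t x.
have msv s : @measurable_fun _ _ (R * Rd)%type Rd (`[0%R, 1%R] `*` setT)
      (fun tx => sv s tx.1 tx.2).
  apply: measurable_fun_rVZ => //; first exact: measurable_unit_cylinder.
have ZI (s : R) (F : R * X -> Rd) : measurable_fun D F ->
    I (fun z => (s *: F z)%R) = (s ^+ 2)%:E * I F.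
  move=> mF; rewrite /I -ge0_integralZl//.
  - by apply: eq_integral => z _; rewrite enormZ exprMn real_normK ?num_real// EFinM.
  - exact: mI.
  - by move=> z _; rewrite lee_fin sqr_ge0.
  - by rewrite lee_fin sqr_ge0.
have adm s : admissible_field gamma (sv s).
  split; first exact: msv.
  rewrite field_energyE//.
  have -> : \int[mu \x gamma]_(z in `[0%R, 1%R] `*` setT)
     (enorm (sv s z.1 (interp z.1 z.2)) ^+ 2)%:E = (s ^+ 2)%:E * I V.
    by rewrite -ZI.
  by rewrite lte_mul_pinfty// lee_fin sqr_ge0.
have lin (a b : R) F G : (0 <= a)%R -> (0 <= b)%R ->
    measurable_fun D F -> measurable_fun D G ->
    a%:E * I F + b%:E * I G =
    \int[mu \x gamma]_(z in D) (a * enorm (F z) ^+ 2 + b * enorm (G z) ^+ 2)%:E.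
  move=> a0 b0 mF mG; rewrite /I -!ge0_integralZl//.
  - rewrite -ge0_integralD//.
    + by move=> z _; rewrite -EFinM lee_fin mulr_ge0 ?sqr_ge0.
    + by apply: measurable_funeM; exact: mI.
    + by move=> z _; rewrite -EFinM lee_fin mulr_ge0 ?sqr_ge0.
    + by apply: measurable_funeM; exact: mI.
  - exact: mI.
  - by move=> z _; rewrite lee_fin sqr_ge0.
  - exact: mI.
  - by move=> z _; rewrite lee_fin sqr_ge0.
(* The quadratic identity is arranged without subtraction: all integrands are nonnegative, so it can
   be integrated before any finiteness is known. *)
have key (s : R) : (0 < s < 1)%R ->
    flow_matching_loss gamma (sv s) + (s * (1 - s))%:E * I V =
    s%:E * flow_matching_loss gamma v + (1 - s)%:E * transport_cost gamma.
  move=> /andP[s0 s1]; have s1' : (0 <= 1 - s)%R by rewrite subr_ge0 ltW.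
  rewrite !lossE// -costE -[X in X + _]mul1e !lin//.
  - apply: eq_integral => z _; congr EFin; rewrite mul1r !enorm2E !mulr_sumr.
    rewrite -!big_split/=; apply: eq_bigr => i _.
    by rewrite /sv /V !mxE; ring.
  - exact: ltW.
  - exact: measurable_fun_rVB.
  - by rewrite mulr_ge0// ltW.
  - apply: measurable_fun_rVB => //; apply: measurable_fun_rVZ => //.
(* The competitor [s = 0] is the zero field, whose loss is the cost. *)
have lfin : flow_matching_loss gamma v < +oo.
  apply: le_lt_trans (vmin _ (adm 0%R)) _; rewrite lossE//.
  rewrite (_ : I _ = transport_cost gamma)// -costE; apply: eq_integral => z _.
  by rewrite /sv scale0r sub0r enormN.
have l0 : 0 <= flow_matching_loss gamma v by rewrite lossE.
have ineq (s : R) : (0 < s < 1)%R ->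
    flow_matching_loss gamma v + (s * (1 - s))%:E * I V <=
    s%:E * flow_matching_loss gamma v + (1 - s)%:E * transport_cost gamma.
  move=> s01; have := key s s01; have := vmin _ (adm s).
  by move=> h <-; exact: leeD2r.
have c0 : 0 <= transport_cost gamma by rewrite -costE.
move: ineq lfin l0 Efin (I0 V) cfin c0.
move: (I V) (transport_cost gamma) (flow_matching_loss gamma v).
move=> [E| |] [c| |] [l| |]//= ineq _; rewrite !lee_fin => l0 _ E0 _ c0.
(* The inequality is divided by [1 - s], then the nonnegative loss [l] is dropped. *)
have {}ineq (s : R) : (0 < s < 1)%R -> (s * E <= c)%R.
  move=> /andP[s0 s1]; have := ineq s; rewrite s0 s1 => /(_ isT).
  rewrite -!EFinM -!EFinD lee_fin => h.
  have s1' : (0 < 1 - s)%R by rewrite subr_gt0.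
  have h3 : (0 <= (1 - s) * l)%R by rewrite mulr_ge0// ltW.
  rewrite -(ler_pM2l s1'); lra.
rewrite leNgt; apply/negP => cE.
have Epos : (0 < E)%R by exact: le_lt_trans cE.
(* This [s] makes [s * E] the midpoint of [c] and [E], which exceeds [c]. *)
have /andP[h1 h2] : (0 < (c / E + 1) / 2 < 1)%R.
  have : (c / E < 1)%R by rewrite ltr_pdivrMr// mul1r.
  have : (0 <= c / E)%R by rewrite divr_ge0// ltW.
  by move=> ? ?; apply/andP; split; lra.
have := ineq ((c / E + 1) / 2)%R; rewrite h1 h2 => /(_ isT).
have -> : ((c / E + 1) / 2 * E = (c + E) / 2)%R by field; rewrite gt_eqF.
lra.
Qed.

(** Jensen's inequality on an interval of length 1, obtained by integrating [2 D h <= h^2 + D^2];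
    the integrals may be infinite. *)
Lemma ler_sqr_integral (h : R -> R) (D : R) :
  @measurable_fun _ _ R R `[0%R, 1%R] h -> (forall t, 0 <= h t)%R -> (0 <= D)%R ->
  D%:E <= \int[mu]_(t in `[0%R, 1%R]) (h t)%:E ->
  (D ^+ 2)%:E <= \int[mu]_(t in `[0%R, 1%R]) (h t ^+ 2)%:E.
Proof.
move=> mh h0 D0 Dh.
have m01 : mu `[0%R, 1%R] = 1 by rewrite lebesgue_measure_itv/= lte_fin ltr01 oppr0 adde0.
have : (2 * D)%:E * \int[mu]_(t in `[0%R, 1%R]) (h t)%:E <=
    \int[mu]_(t in `[0%R, 1%R]) (h t ^+ 2)%:E + (D ^+ 2)%:E.
  rewrite -[X in _ + X]mule1 -m01 -(integral_cst mu (measurable_itv _)).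
  rewrite -ge0_integralZl//; last 3 first.
  - exact/measurable_EFinP.
  - by move=> t _; rewrite lee_fin.
  - by rewrite lee_fin mulr_ge0.
  rewrite -ge0_integralD//; last 3 first.
  - by move=> t _; rewrite lee_fin sqr_ge0.
  - by apply/measurable_EFinP/measurable_funX.
  - by move=> t _; rewrite lee_fin sqr_ge0.
  apply: ge0_le_integral => //.
  - by move=> t _; rewrite -EFinM lee_fin !mulr_ge0.
  - by apply: measurable_funeM; exact/measurable_EFinP.
  - by apply: emeasurable_funD => //; apply/measurable_EFinP/measurable_funX.
  - move=> t _ /=; rewrite -EFinM -EFinD lee_fin.
    by have := sqr_ge0 (h t - D)%R; rewrite sqrrB; lra.
have : (2 * D ^+ 2)%:E <= (2 * D)%:E * \int[mu]_(t in `[0%R, 1%R]) (h t)%:E.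
  by rewrite expr2 mulrA EFinM lee_wpmul2l// lee_fin mulr_ge0.
move=> /le_trans /[apply].
have : 0 <= \int[mu]_(t in `[0%R, 1%R]) (h t ^+ 2)%:E.
  by apply: integral_ge0 => t _; rewrite lee_fin sqr_ge0.
case: (\int[mu]_(t in _) _) => [r| |]//= _; rewrite ?leey// -EFinD !lee_fin; lra.
Qed.

(** By the marginal condition at each time and Tonelli, the energy of [v] is the [Lambda]-mean of
    the kinetic energies of the curves; each of these dominates the squared displacement. *)
Lemma curve_kinetic_le (gamma : probability X R) (v : R -> Rd -> Rd)
    (Lambda : probability (curve R d) R) :
  admissible_field gamma v ->
  {ae Lambda, forall l, absolutely_continuous (curve_at l)} ->
  {ae Lambda, forall l, {ae lebesgue_measure, forall t : R,
    t \in `]0%R, 1%R[ -> is_derive t 1%R (curve_at l) (v t (curve_at l t))}} ->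
  (forall psi : Rd -> R, continuous psi -> compactly_supported psi ->
    forall t, t \in `[0%R, 1%R] ->
    (\int[interpolation gamma t]_x (psi x)%:E =
     \int[Lambda]_l (psi (curve_at l t))%:E)%E) ->
  \int[Lambda]_l (enorm (curve_at l 0%R - curve_at l 1%R) ^+ 2)%:E <=
  \int[mu]_(t in `[0%R, 1%R])
     \int[interpolation gamma t]_x (enorm (v t x) ^+ 2)%:E.
Proof.
move=> [mv _] acL odeL marg.
pose V (z : R * curve R d) := v z.1 (curve_at z.2 z.1).
have mV : measurable_fun (`[0%R, 1%R] `*` setT : set (R * curve R d)) V.
  exact: (field_along_measurable mv (@measurable_curve_at_pair R d)).
have mV2 : measurable_fun (`[0%R, 1%R] `*` setT : set (R * curve R d))
    (fun z => (enorm (V z) ^+ 2)%:E).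
  exact/measurable_EFinP/measurable_funX/measurable_fun_enorm.
have V20 z : 0 <= (enorm (V z) ^+ 2)%:E by rewrite lee_fin sqr_ge0.
have -> : \int[mu]_(t in `[0%R, 1%R])
     \int[interpolation gamma t]_x (enorm (v t x) ^+ 2)%:E =
   \int[Lambda]_l \int[mu]_(t in `[0%R, 1%R]) (enorm (V (t, l)) ^+ 2)%:E.
  rewrite (integral_space_first _ mV2)// -(integral_time_first _ mV2)//.
  apply: eq_integral => t; rewrite inE/= => t01.
  have mvt : measurable_fun setT (fun x => (enorm (v t x) ^+ 2)%:E).
    apply/measurable_EFinP/measurable_funX/measurable_fun_enorm.
    by apply: (measurable_space_section mv); rewrite in_itv in t01.
  rewrite /interpolation ge0_integral_pushforwardT//.
  - apply: (Cc_law_unique (measurable_interp t) (measurable_curve_at t)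
      _ mvt) => //.
    + move=> psi cpsi spsi psi0; rewrite -marg//.
      rewrite /interpolation ge0_integral_pushforwardT//.
      * exact: measurable_interp.
      * by apply/measurable_EFinP; exact: continuous_measurable_rV.
    + by move=> x; rewrite lee_fin sqr_ge0.
  - exact: measurable_interp.
  - by move=> x; rewrite lee_fin sqr_ge0.
apply: ae_ge0_le_integral => //.
- by move=> l _; rewrite lee_fin sqr_ge0.
- apply/measurable_EFinP/measurable_funX/measurable_fun_enorm.
  by apply: measurable_fun_rVB => //; exact: measurable_curve_at.
- by move=> l _; apply: integral_ge0 => t _; exact: V20.
- exact: (measurable_time_integral mV2 V20).
apply: filterS2 acL odeL => l acl odel _.
(* The speed is measured by the field along the curve, which is measurable in [t]; the derivative
   itself exists only almost everywhere. *)
have mg : @measurable_fun _ _ R R `[0%R, 1%R] (fun t => enorm (V (t, l))).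
  by apply: measurable_fun_enorm; exact: (measurable_time_section (F := V)).
apply: (ler_sqr_integral mg) => [t||]; [exact: enorm_ge0|exact: enorm_ge0|].
rewrite enormB; apply: (ac_increment_le acl mg) => [t|]; first exact: enorm_ge0.
move: odel => [N [mN N0 NE]]; exists N; split => // t /= nt.
by apply: NE => /= ode; apply: nt => t01; exists (v t (curve_at l t)) => //; exact: ode.
Qed.

End Energy.

(** * Smooth cutoffs of the cost *)

Section FlatBump.
Variable R : realType.
Implicit Types (m : nat) (u : R).

(* The derivatives of [exp (- 1 / u)], extended by [0] to [u <= 0], are
   combinations of these functions. *)
Definition flat_bump m u : R := if 0 < u then u^-1 ^+ m * expR (- u^-1) else 0.

Lemma flat_bump_ge0 m u : 0 <= flat_bump m u.
Proof.
rewrite /flat_bump; case: ifPn => // u0.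
by rewrite mulr_ge0 ?expR_ge0// exprn_ge0// invr_ge0 ltW.
Qed.

(** One term of the exponential series at [1 / u], of degree [m + 2]: two powers of [u] remain,
    enough for a zero derivative at 0. *)
Lemma flat_bump_le m u : flat_bump m u <= (m.+2)`!%:R * u ^+ 2.
Proof.
rewrite /flat_bump; case: ifPn => [u0|_]; last by rewrite mulr_ge0// sqr_ge0.
have ui : 0 < u^-1 by rewrite invr_gt0.
have := @expR_ge1Dxn R (u^-1) m.+1 (ltW ui).
have f0 : 0 < (m.+2)`!%:R :> R by rewrite ltr0n fact_gt0.
rewrite expRN ler_pdivrMr ?expR_gt0// => h.
have {}h : u^-1 ^+ m.+2 <= (m.+2)`!%:R * expR u^-1.
  by rewrite mulrC -ler_pdivrMr//; apply: le_trans h; rewrite lerDr.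
rewrite mulrAC -ler_pdivrMr ?exprn_gt0//; apply: le_trans h.
by rewrite -exprVn -exprD addn2.
Qed.

Lemma cvg_is_derive (f : R -> R) (x D : R) :
  h^-1 *: ((f \o shift x) (h *: (1 : R)) - f x) @[h --> 0^'] --> D ->
  is_derive x 1 f D.
Proof.
by move=> E; split; [apply/cvg_ex; exists D|exact: (cvg_lim _ E)].
Qed.

Lemma near_eq_is_derive (f g : R -> R) (x D : R) : (\forall y \near x, f y = g y) ->
  is_derive x 1 f D -> is_derive x 1 g D.
Proof.
move=> fg [df dE].
have E : (h^-1 *: ((f \o shift x) (h *: (1 : R)) - f x)) @[h --> 0^'] --> D.
  by rewrite -dE; exact: df.
have fgx : f x = g x := nbhs_singleton fg.
have cx : (fun h : R => h *: (1 : R) + x) @ 0^' --> x.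
  rewrite (_ : (fun h : R => _) = (id \o shift x)).
    by apply/continuous_withinNshiftx; exact: cvg_id.
  by apply/funext => h; rewrite /= [h *: _]mulr1.
have E' : (h^-1 *: ((g \o shift x) (h *: (1 : R)) - g x)) @[h --> 0^'] --> D.
  apply: cvg_trans E; apply: near_eq_cvg.
  near=> h; rewrite fgx /=; congr (_ *: (_ - _)).
  by near: h; exact: (cx _ fg).
exact: cvg_is_derive.
Unshelve. all: by end_near. Qed.

Lemma is_derive_expVn m u : u != 0 ->
  is_derive u 1 (fun y : R => y^-1 ^+ m * expR (- y^-1))
    (u^-1 ^+ m.+2 * expR (- u^-1) - m%:R * (u^-1 ^+ m.+1 * expR (- u^-1))).
Proof.
move=> u0.
have dV : is_derive u 1 (fun y : R => y^-1) (- u ^- 2 *: 1).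
  exact: is_deriveV.
have dP (w : R) : is_derive w 1 (fun y : R => y ^+ m * expR (- y))
    (w ^+ m *: (expR (- w) * -1) + expR (- w) *: (m%:R * w ^+ m.-1 *: 1)).
  apply: (@is_deriveM R R (fun y : R => y ^+ m) (fun y : R => expR (- y))).
    by have := @is_deriveX R R id m w 1 1 (is_derive_id _ _); rewrite fctE.
have := is_derive1_comp (dP u^-1) dV.
move=> h; apply: (is_derive_eq h).
rewrite -[_ *: 1]/(_ * 1) /GRing.scale/= -!exprVn !mulr1.
case: m {dP h} => [|m]; first by rewrite !mul0r mulr0; ring.
by rewrite !exprS; ring.
Qed.

Lemma is_derive_flat_bump m u :
  is_derive u 1 (flat_bump m) (flat_bump m.+2 u - m%:R * flat_bump m.+1 u).
Proof.
have [u0|u0|u0] := ltrgtP 0 u.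
- have -> : flat_bump m.+2 u - m%:R * flat_bump m.+1 u =
    u^-1 ^+ m.+2 * expR (- u^-1) - m%:R * (u^-1 ^+ m.+1 * expR (- u^-1)).
    by rewrite /flat_bump u0.
  apply: (@near_eq_is_derive (fun y => y^-1 ^+ m * expR (- y^-1))).
    by near=> y; rewrite /flat_bump ifT//; near: y; exact: cvgr_gt _ cvg_id _ u0.
  by apply: is_derive_expVn; rewrite gt_eqF.
- have -> : flat_bump m.+2 u - m%:R * flat_bump m.+1 u = 0.
    by rewrite /flat_bump !ifF ?mulr0 ?subr0//; apply/negbTE; rewrite -leNgt ltW.
  apply: (@near_eq_is_derive (cst 0)).
  near=> y; rewrite /flat_bump ifF//; apply/negbTE; rewrite -leNgt ltW//; near: y.
  exact: cvgr_lt _ cvg_id _ u0.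
- rewrite -{}u0.
  have -> : flat_bump m.+2 0 - m%:R * flat_bump m.+1 0 = 0.
    by rewrite /flat_bump ltxx mulr0 subr0.
  have E : (h^-1 *: ((flat_bump m \o shift 0) (h *: (1 : R)) - flat_bump m 0))
      @[h --> 0^'] --> (0 : R).
    (* The quadratic bound makes the difference quotient at 0 at most [(m+2)! |h|]. *)
    apply: (@cvg_to_0_linear _ _ (m.+2)`!%:R 1) => // h /andP[h0 _].
    rewrite /= addr0 [h *: 1]mulr1 {2}/flat_bump ltxx subr0 normrM.
    rewrite normfV -[X in _ <= X]mulr1 -ler_pdivlMl ?invr_gt0// invrK.
    rewrite ger0_norm ?flat_bump_ge0//; apply: (le_trans (flat_bump_le _ _)).
    rewrite -(real_normK (num_real h)) le_eqVlt; apply/orP; left; apply/eqP; ring.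
  exact: cvg_is_derive.
Unshelve. all: by end_near. Qed.

Lemma differentiable_flat_bump m u : differentiable (flat_bump m) u.
Proof. by apply/derivable1_diffP; have [] := is_derive_flat_bump m u. Qed.

Lemma continuous_flat_bump m : continuous (flat_bump m).
Proof. by move=> u; apply: differentiable_continuous; exact: differentiable_flat_bump. Qed.

End FlatBump.

(** * A class of functions stable under differentiation *)

Section SmoothExpressions.
Variables (R : realType) (V : normedModType R).

(** Built to be stable under every ['D_v], so that [C_k] follows by induction on [k]. All indices
    [m] are present because differentiating the bump of index [m] produces those of index [m + 1]
    and [m + 2]. *)
Inductive smooth_expr : (V -> R) -> Prop :=
| smooth_expr_cst c : smooth_expr (fun=> c)
| smooth_expr_linear (f : {linear V -> R}) : continuous f -> smooth_expr f
| smooth_expr_add f g : smooth_expr f -> smooth_expr g ->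
    smooth_expr (fun x => f x + g x)
| smooth_expr_mul f g : smooth_expr f -> smooth_expr g ->
    smooth_expr (fun x => f x * g x)
| smooth_expr_bump m f : smooth_expr f -> smooth_expr (fun x => flat_bump m (f x)).

Lemma smooth_expr_differentiable f : smooth_expr f -> forall x, differentiable f x.
Proof.
elim=> {f} [c x|f cf x|f g _ hf _ hg x|f g _ hf _ hg x|m f _ hf x].
- exact: differentiable_cst.
- exact: linear_differentiable.
- exact: differentiableD.
- exact: differentiableM.
- by apply: (@differentiable_comp _ _ _ _ f (flat_bump m)) => //; exact: differentiable_flat_bump.
Qed.

Lemma smooth_expr_derive f v : smooth_expr f -> smooth_expr (fun x => 'D_v f x).
Proof.
elim=> {f} [c|f cf|f g sf hf sg hg|f g sf hf sg hg|m f sf hf].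
- rewrite (_ : 'D_v _ = fun=> 0); first exact: smooth_expr_cst.
  by apply/funext => x; exact: derive_cst.
- rewrite (_ : 'D_v _ = fun=> f v); first exact: smooth_expr_cst.
  apply/funext => x; rewrite deriveE; last exact: linear_differentiable.
  by rewrite diff_lin.
- rewrite (_ : 'D_v _ = fun x => 'D_v f x + 'D_v g x); first exact: smooth_expr_add.
  apply/funext => x; apply: deriveD; apply: diff_derivable; exact: smooth_expr_differentiable.
- rewrite (_ : 'D_v _ = fun x => f x * 'D_v g x + g x * 'D_v f x).
    by apply: smooth_expr_add; exact: smooth_expr_mul.
  apply/funext => x; apply: deriveM; apply: diff_derivable; exact: smooth_expr_differentiable.
- rewrite (_ : 'D_v _ = fun x => (flat_bump m.+2 (f x) +
    (- m%:R) * flat_bump m.+1 (f x)) * 'D_v f x).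
    apply: smooth_expr_mul => //; apply: smooth_expr_add; first exact: smooth_expr_bump.
    by apply: smooth_expr_mul; [exact: smooth_expr_cst|exact: smooth_expr_bump].
  apply/funext => x.
  have df := smooth_expr_differentiable sf x.
  have db := @differentiable_flat_bump R m (f x).
  rewrite deriveE; last exact: (@differentiable_comp _ _ _ _ f (flat_bump m)).
  rewrite (@diff_comp _ _ _ _ f (flat_bump m))//= deriveE// diff1E//.
  rewrite derive1E (@derive_val _ _ _ _ _ _ _ (is_derive_flat_bump m (f x))).
  by rewrite /GRing.scale/= mulNr mulrC.
Qed.

Lemma smooth_expr_smooth f : smooth_expr f -> smooth f.
Proof.
move=> sf k; elim: k f sf => [|k IHk] f sf /=; split => //.
- by move=> x; apply: differentiable_continuous; exact: smooth_expr_differentiable.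
- by move=> x; apply: differentiable_continuous; exact: smooth_expr_differentiable.
- move=> v; split; last exact/IHk/smooth_expr_derive.
  by move=> x; apply: diff_derivable; exact: smooth_expr_differentiable.
Qed.

Lemma smooth_expr_sum (I : Type) (s : seq I) (F : I -> V -> R) :
  (forall i, smooth_expr (F i)) -> smooth_expr (fun x => \sum_(i <- s) F i x).
Proof.
move=> sF; elim: s => [|i s IHs].
  by under eq_fun do rewrite big_nil; exact: smooth_expr_cst.
by under eq_fun do rewrite big_cons; exact: smooth_expr_add.
Qed.

End SmoothExpressions.

Section SmoothCutoff.
Variables (R : realType) (d : nat).
Local Notation Rd := 'rV[R]_d.
Local Notation X := (Rd * Rd)%type.

Definition coord_fst (i : 'I_d) (p : X) : R := p.1 ord0 i.
Definition coord_snd (i : 'I_d) (p : X) : R := p.2 ord0 i.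

Fact coord_fst_is_linear i : linear (coord_fst i).
Proof. by move=> a p q; rewrite /coord_fst/= !mxE. Qed.

Fact coord_snd_is_linear i : linear (coord_snd i).
Proof. by move=> a p q; rewrite /coord_snd/= !mxE. Qed.

HB.instance Definition _ i :=
  GRing.isLinear.Build R X R _ (coord_fst i) (coord_fst_is_linear i).
HB.instance Definition _ i :=
  GRing.isLinear.Build R X R _ (coord_snd i) (coord_snd_is_linear i).

Lemma smooth_expr_coord_fst i : smooth_expr (coord_fst i).
Proof.
apply: (@smooth_expr_linear _ _ (coord_fst i)) => p.
apply: (@continuous_comp _ _ _ fst (fun v : Rd => v ord0 i)); first exact: cvg_fst.
exact: coord_continuous.
Qed.

Lemma smooth_expr_coord_snd i : smooth_expr (coord_snd i).
Proof.
apply: (@smooth_expr_linear _ _ (coord_snd i)) => p.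
apply: (@continuous_comp _ _ _ snd (fun v : Rd => v ord0 i)); first exact: cvg_snd.
exact: coord_continuous.
Qed.

Definition pair_sqnorm (p : X) : R := enorm p.1 ^+ 2 + enorm p.2 ^+ 2.

Lemma pair_sqnorm_ge0 p : 0 <= pair_sqnorm p.
Proof. by rewrite addr_ge0 ?sqr_ge0. Qed.

Lemma measurable_pair_sqnorm : measurable_fun setT pair_sqnorm.
Proof.
by apply: measurable_funD; apply: measurable_funX; exact: measurable_fun_enorm.
Qed.

Lemma smooth_expr_pair_sqnorm : smooth_expr pair_sqnorm.
Proof.
rewrite (_ : pair_sqnorm = fun p => \sum_(i < d) coord_fst i p * coord_fst i p +
    \sum_(i < d) coord_snd i p * coord_snd i p).
  apply: smooth_expr_add; apply: smooth_expr_sum => i;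
    by apply: smooth_expr_mul; first [exact: smooth_expr_coord_fst|exact: smooth_expr_coord_snd].
by apply/funext => p; rewrite /pair_sqnorm !enorm2E.
Qed.

Lemma smooth_expr_cost : smooth_expr (fun p : X => enorm (p.1 - p.2) ^+ 2).
Proof.
rewrite (_ : (fun p : X => _) = fun p => \sum_(i < d)
    (coord_fst i p + (-1) * coord_snd i p) * (coord_fst i p + (-1) * coord_snd i p)).
  have h i : smooth_expr (fun p => coord_fst i p + (-1) * coord_snd i p).
    apply: smooth_expr_add; first exact: smooth_expr_coord_fst.
    by apply: smooth_expr_mul; [exact: smooth_expr_cst|exact: smooth_expr_coord_snd].
  by apply: smooth_expr_sum => i; exact: smooth_expr_mul.
by apply/funext => p; rewrite enorm2E; apply: eq_bigr => i _; rewrite !mxE mulN1r.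
Qed.

(** The factor [expR 1] normalizes the bump to 1 at argument 1, the limit as [k] grows; the bump
    vanishes once [pair_sqnorm p] reaches [k + 1]. The sum with an opposite matches the constructors
    of [smooth_expr]. *)
Definition cost_cutoff (k : nat) (p : X) : R := enorm (p.1 - p.2) ^+ 2 *
  (expR 1 * flat_bump 0 (1 + - k.+1%:R^-1 * pair_sqnorm p)).

Lemma smooth_cost_cutoff k : smooth (cost_cutoff k).
Proof.
apply: smooth_expr_smooth; apply: smooth_expr_mul; first exact: smooth_expr_cost.
apply: smooth_expr_mul; first exact: smooth_expr_cst.
apply: smooth_expr_bump; apply: smooth_expr_add; first exact: smooth_expr_cst.
by apply: smooth_expr_mul; [exact: smooth_expr_cst|exact: smooth_expr_pair_sqnorm].
Qed.

Lemma measurable_cost_cutoff k : measurable_fun setT (cost_cutoff k).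
Proof.
have /measurable_EFinP mc := @measurable_transport_integrand R d.
apply: measurable_funM => //.
apply: measurable_funM => //.
apply: (measurableT_comp (continuous_measurable_fun (@continuous_flat_bump R 0))).
apply: measurable_funD => //; apply: measurable_funM => //.
exact: measurable_pair_sqnorm.
Qed.

Lemma compactly_supported_cost_cutoff k : compactly_supported (cost_cutoff k).
Proof.
pose A := closure [set x : Rd | enorm x <= k.+1%:R].
have cA : compact A by apply: (@bounded_compact_closure _ _ k.+1%:R).
have cAA : compact (A `*` A) by exact: compact_setX.
apply: (subclosed_compact _ cAA); first exact: closed_closure.
have /closure_id -> : closed (A `*` A).
  by apply: compact_closed cAA; exact: norm_hausdorff.
apply: closure_subset => p /= p0.
have pk : pair_sqnorm p <= k.+1%:R.
  rewrite leNgt; apply/negP => kp; move/eqP: p0; apply.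
  rewrite /cost_cutoff /flat_bump ifF ?mulr0//; apply/negbTE; rewrite -leNgt.
  by rewrite mulNr subr_le0 ler_pdivlMl// mulr1 ltW.
(* As [k + 1] is at least 1, it can serve as a radius in place of its square root. *)
have small (a : R) : 0 <= a -> a ^+ 2 <= k.+1%:R -> a <= k.+1%:R.
  move=> a0 ak; rewrite -ler_sqr ?nnegrE//; apply: le_trans ak _.
  by rewrite expr2 ler_peMl// ler1n.
split; apply: subset_closure => /=; apply: small; rewrite ?enorm_ge0//;
  by apply: le_trans pk; rewrite /pair_sqnorm ?lerDl ?lerDr sqr_ge0.
Qed.

Lemma flat_bump0_homo : {homo @flat_bump R 0 : u w / u <= w}.
Proof.
move=> u w uw; rewrite /flat_bump; case: ifPn => [u0|_]; last exact: flat_bump_ge0.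
have w0 : 0 < w by exact: lt_le_trans uw.
by rewrite w0 !expr0 !mul1r ler_expR lerN2 lef_pV2.
Qed.

Lemma cost_cutoff_ge0 k p : 0 <= cost_cutoff k p.
Proof.
rewrite /cost_cutoff mulr_ge0 ?sqr_ge0// mulr_ge0 ?expR_ge0//.
exact: flat_bump_ge0.
Qed.

Lemma cost_cutoff_le k p : cost_cutoff k p <= enorm (p.1 - p.2) ^+ 2.
Proof.
rewrite ler_piMr ?sqr_ge0//.
have E : expR 1 * flat_bump 0 1 = 1 :> R.
  by rewrite /flat_bump ltr01 expr0 mul1r invr1 -expRD subrr expR0.
rewrite -[leRHS]E ler_wpM2l ?expR_ge0//; apply: flat_bump0_homo.
by rewrite gerDl mulNr oppr_le0 mulr_ge0 ?pair_sqnorm_ge0.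
Qed.

Lemma cost_cutoff_nd p : {homo (fun k => cost_cutoff k p) : m n / (m <= n)%N >-> m <= n}.
Proof.
move=> m n mn; rewrite ler_wpM2l ?sqr_ge0// ler_wpM2l ?expR_ge0//.
apply: flat_bump0_homo; rewrite lerD2l !mulNr lerN2.
by rewrite ler_wpM2r ?pair_sqnorm_ge0// lef_pV2 ?posrE// ler_nat.
Qed.

Lemma cvg_cost_cutoff p : cost_cutoff k p @[k --> \oo] --> enorm (p.1 - p.2) ^+ 2.
Proof.
have E : enorm (p.1 - p.2) ^+ 2 = enorm (p.1 - p.2) ^+ 2 * (expR 1 * flat_bump 0 1).
  by rewrite /flat_bump ltr01 expr0 mul1r invr1 -expRD subrr expR0 mulr1.
rewrite [X in _ --> X]E; apply: cvgMr; apply: cvgMr.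
apply: continuous_cvg; first exact: continuous_flat_bump.
rewrite -[X in _ --> X]addr0; apply: cvgD; first exact: cvg_cst.
rewrite -(mul0r (pair_sqnorm p)) -{1}oppr0; apply: cvgMl; apply: cvgN.
exact: cvg_harmonic.
Qed.

(* The smooth compactly supported cutoffs increase to the cost. *)
Lemma transport_cost_le_test d' (T : measurableType d') (P : probability X R)
    (L : probability T R) (e : T -> X) :
  measurable_fun setT e ->
  (forall psi : X -> R, smooth psi -> compactly_supported psi ->
    (\int[P]_p (psi p)%:E = \int[L]_l (psi (e l))%:E)%E) ->
  (transport_cost P <= \int[L]_l (enorm ((e l).1 - (e l).2) ^+ 2)%:E)%E.
Proof.
move=> me H.
have mk k : measurable_fun setT (fun p => (cost_cutoff k p)%:E).
  by apply/measurable_EFinP; exact: measurable_cost_cutoff.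
have cv : (\int[P]_p (cost_cutoff k p)%:E)%E @[k --> \oo] --> transport_cost P.
  have := @cvg_monotone_convergence _ _ _ P setT measurableT
    (fun k p => (cost_cutoff k p)%:E) mk _ _.
  rewrite (_ : \int[P]_x _ = transport_cost P)%E; last first.
    apply: eq_integral => p _; apply/cvg_lim => //; apply: cvg_EFin.
      by apply: nearW.
    exact: cvg_cost_cutoff.
  apply; first by move=> k p _; rewrite lee_fin cost_cutoff_ge0.
  by move=> p _ m n mn; rewrite lee_fin cost_cutoff_nd.
rewrite -(cvg_lim _ cv)//; apply: lime_le; first by apply/cvg_ex; exists (transport_cost P).
apply: nearW => k.
rewrite H; [|exact: smooth_cost_cutoff|exact: compactly_supported_cost_cutoff].
apply: ge0_le_integral => //.
- by move=> l _; rewrite lee_fin cost_cutoff_ge0.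
- exact: (measurableT_comp (mk k) me).
- exact: (measurableT_comp (@measurable_transport_integrand R d) me).
- by move=> l _; rewrite lee_fin cost_cutoff_le.
Qed.

Lemma weak_rectified_cost_le (gamma gamma' : probability X R) :
  (transport_cost gamma < +oo)%E -> weak_rectified gamma gamma' ->
  (transport_cost gamma' <= transport_cost gamma)%E.
Proof.
move=> cfin [v [Lambda [vf acL odeL marg0 marg01]]].
apply: le_trans (velocity_energy_le cfin vf).
apply: le_trans (curve_kinetic_le vf.1 acL odeL marg0).
apply: (transport_cost_le_test (e := fun l => (curve_at l 0, curve_at l 1))) => //.
by apply: measurable_fun_pair; exact: measurable_curve_at.
Qed.

End SmoothCutoff.

(** * The minibatch step *)

Section PowerProbability.
Local Open Scope ereal_scope.
Context d (T : measurableType d) (R : realType) (P : probability T R).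

Lemma ge0_integral_powerS n (f : n.+1.-tuple T -> \bar R) :
  measurable_fun setT f -> (forall z, 0 <= f z) ->
  \int[power_probability P n.+1]_z f z =
  \int[P]_x \int[power_probability P n]_t f (cons_pair (x, t)).
Proof.
move=> mf f0; rewrite /= ge0_integral_distribution// fubini_tonelli1//.
  by apply: measurableT_comp => //; exact: measurable_cons_pair.
by move=> x; exact: f0.
Qed.

Lemma integral_power_tnth n (i : 'I_n) (h : T -> \bar R) :
  measurable_fun setT h -> (forall x, 0 <= h x) ->
  \int[power_probability P n]_z h (tnth z i) = \int[P]_x h x.
Proof.
move=> mh h0; elim: n i => [[]//|n IHn] i.
rewrite ge0_integral_powerS//; last first.
  by apply: measurableT_comp => //; exact: measurable_tnth.
have [j ->|->] := unliftP ord0 i.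
  under eq_integral do under eq_integral do rewrite /cons_pair tnthS/=.
  by rewrite IHn integral_cst//= probability_setT mule1.
under eq_integral do under eq_integral do rewrite /cons_pair tnth0/=.
by apply: eq_integral => x _; rewrite integral_cst//= probability_setT mule1.
Qed.

Lemma power_probability_setX n (U : 'I_n -> set T) :
  (forall i, measurable (U i)) ->
  power_probability P n [set z | forall i, U i (tnth z i)] = \prod_(i < n) P (U i).
Proof.
elim: n U => [|n IHn] U mU.
  rewrite big_ord0 /= (_ : [set _ | _] = setT) ?probability_setT//.
  by apply/seteqP; split => // z _ [].
rewrite big_ord_recl -(IHn (fun j => U (lift ord0 j)))// -product_measure1E//.
  rewrite /= /distribution /pushforward; congr (product_measure1 _ _ _).
  apply/seteqP; split => [[x t] /= h|[x t] [/= h0 h] i].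
    by split => [|j]; [have := h ord0; rewrite tnth0|have := h (lift ord0 j); rewrite tnthS].
  by have [j ->|->] := unliftP ord0 i; rewrite ?tnthS ?tnth0.
rewrite (_ : [set _ | _] = \bigcap_(j : 'I_n) (fun t => tnth t j) @^-1` U (lift ord0 j)).
  rewrite -[X in measurable X]setCK setC_bigcap; apply: measurableC.
  apply: countable_bigcupT_measurable => // j; apply: measurableC.
  by rewrite -[X in measurable X]setTI; exact: measurable_tnth.
by apply/seteqP; split => t /= h j; [move=> _; exact: h|exact: h].
Qed.

End PowerProbability.

Section MinibatchCost.
Local Open Scope ereal_scope.
Variables (R : realType) (d N : nat).
Local Notation Rd := 'rV[R]_d.
Local Notation X := (Rd * Rd)%type.
Variables (sigma : N.-tuple X -> 'S_N) (gamma gammaN : probability X R).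
Hypothesis sigmaP : ot_selection sigma.
Hypothesis gammaNE : forall A, measurable A -> gammaN A = minibatch_ot sigma gamma A.

Let c (p : X) : \bar R := (enorm (p.1 - p.2)%R ^+ 2)%:E.

Let mc : measurable_fun setT c. Proof. exact: measurable_transport_integrand. Qed.

Let c0 p : 0 <= c p. Proof. by rewrite lee_fin sqr_ge0. Qed.

Lemma measurable_batch_cost tau :
  measurable_fun setT (fun z : N.-tuple X => batch_cost z tau).
Proof.
apply: measurable_sum => i; apply: measurable_funX; apply: measurable_fun_enorm.
apply: measurable_fun_rVB => //.
  exact: (measurableT_comp measurable_fst (measurable_tnth _)).
exact: (measurableT_comp measurable_snd (measurable_tnth _)).
Qed.

(** The batches split into finitely many measurable sets, on each of which the matched index is
    constant. *)
Lemma measurable_rematch i : measurable_fun setT (rematch sigma i).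
Proof.
apply: measurable_fun_pair.
  exact: (measurableT_comp measurable_fst (measurable_tnth _)).
move=> _ A mA; rewrite setTI.
rewrite (_ : _ @^-1` A = \bigcup_(tau : 'S_N) ([set z | sigma z = tau] `&`
    (fun z => (tnth z (tau i)).2) @^-1` A)).
  apply: countable_bigcupT_measurable => [|tau]; first exact: countableP.
  apply: measurableI.
    exact: sigmaP.1.
  rewrite -[X in measurable X]setTI.
  exact: (measurableT_comp measurable_snd (measurable_tnth _)).
apply/seteqP; split => [z zA|z [tau _ [/= -> ]]//].
by exists (sigma z).
Qed.

Lemma minibatch_transport_costE : (0 < N)%N ->
  N%:R%:E * transport_cost gammaN =
  \int[power_probability gamma N]_z (batch_cost z (sigma z))%:E.
Proof.
move=> N0; case: N N0 sigma sigmaP gammaNE (measurable_rematch) => // n _ s sP gE mr.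
pose G := power_probability gamma n.+1.
(* [msum] takes a family of measures indexed by [nat], hence the detour through [inord], which
   requires a successor for [N]. *)
pose r (k : nat) : {mfun n.+1.-tuple X >-> X} := HB.pack (rematch s (inord k))
  (isMeasurableFun.Build _ _ _ _ _ (mr (inord k))).
pose m k := distribution G (r k).
have n0 : (0 <= n.+1%:R^-1 :> R)%R by [].
have -> : transport_cost gammaN = \int[mscale (NngNum n0) (msum m n.+1)]_p c p.
  apply: eq_measure_integral => A mA _.
  transitivity (minibatch_ot s gamma A); first exact: gE.
  rewrite /minibatch_ot /mscale/= /msum/=.
  by congr (_ * _); apply: eq_bigr => i _; rewrite /m /distribution /r/= inord_val.
rewrite ge0_integral_mscale//= ge0_integral_measure_sum//.
rewrite muleA -EFinM divff// mul1e.
rewrite (_ : (fun z => _) = fun z => (\sum_(i < n.+1) c (rematch s i z))%E); last first.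
  by apply/funext => z; rewrite /batch_cost -sumEFin.
rewrite ge0_integral_sum//; last by move=> i; exact: measurableT_comp.
apply: eq_bigr => i _; transitivity (\int[G]_z (c \o r i) z).
  exact: ge0_integral_distribution.
by apply: eq_integral => z _; rewrite /= /r/= inord_val.
Qed.

Lemma batch_cost_id_integral :
  N%:R%:E * transport_cost gamma =
  \int[power_probability gamma N]_z (batch_cost z 1%g)%:E.
Proof.
rewrite (_ : (fun z => _) = fun z : N.-tuple X => (\sum_(i < N) c (tnth z i))%E); last first.
  by apply/funext => z; rewrite /batch_cost -sumEFin; apply: eq_bigr => i _; rewrite perm1.
rewrite ge0_integral_sum//; last first.
  by move=> i; apply: measurableT_comp => //; exact: measurable_tnth.
rewrite (eq_bigr (fun=> 1%:E * transport_cost gamma)).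
  by rewrite -ge0_sume_distrl// sumEFin sumr_const card_ord.
by move=> i _; rewrite mul1e (integral_power_tnth _ _ mc c0).
Qed.

(** Integrates the pointwise bound in which an optimal matching saves at least [delta] on the
    product of the [U i]. The additive form is meaningful for infinite costs, and [delta = 0] gives
    plain monotonicity. *)
Lemma minibatch_cost_gap (U : 'I_N -> set X) (delta : R) : (0 < N)%N ->
  (forall i, measurable (U i)) -> (0 <= delta)%R ->
  (forall z : N.-tuple X, (forall i, U i (tnth z i)) -> exists tau,
    batch_cost z tau + delta <= batch_cost z 1%g)%R ->
  N%:R%:E * transport_cost gammaN + delta%:E * \prod_(i < N) gamma (U i) <=
  N%:R%:E * transport_cost gamma.
Proof.
move=> N0 mU d0 Ud.
rewrite minibatch_transport_costE// batch_cost_id_integral -power_probability_setX//.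
set W := [set z | _].
have mW : measurable W.
  rewrite (_ : W = \bigcap_(j : 'I_N) (fun t => tnth t j) @^-1` U j).
    rewrite -[X in measurable X]setCK setC_bigcap; apply: measurableC.
    apply: countable_bigcupT_measurable => // j; apply: measurableC.
    by rewrite -[X in measurable X]setTI; exact: measurable_tnth.
  by apply/seteqP; split => t /= h j; [move=> _; exact: h|exact: h].
have b0 (z : N.-tuple X) tau : (0 <= batch_cost z tau)%R by apply: sumr_ge0 => i _; exact: sqr_ge0.
have ms : measurable_fun setT (fun z => (batch_cost z (sigma z))%:E).
  rewrite (_ : (fun z => _) = fun z => (\sum_(i < N) c (rematch sigma i z))%E).
    by apply: emeasurable_sum => i; apply: measurableT_comp => //; exact: measurable_rematch.
  by apply/funext => z; rewrite /batch_cost -sumEFin.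
rewrite -[W]setIT -integral_indic//= -ge0_integralZl//; last first.
  by apply/measurable_EFinP; exact/measurable_indicP.
rewrite -ge0_integralD//; last 3 first.
- by move=> z _; rewrite lee_fin.
- by move=> z _; rewrite -EFinM lee_fin mulr_ge0.
- by apply: measurable_funeM; apply/measurable_EFinP; exact/measurable_indicP.
apply: ge0_le_integral => //.
- by move=> z _; apply: adde_ge0; [|apply: mule_ge0]; rewrite lee_fin.
- apply: emeasurable_funD => //.
  by apply: measurable_funeM; apply/measurable_EFinP; exact/measurable_indicP.
- by apply/measurable_EFinP; exact: measurable_batch_cost.
- move=> z _; rewrite -EFinM -EFinD lee_fin indicE.
  have [Wz|Wz] := boolP (z \in W); last by rewrite mulr0 addr0; exact: sigmaP.2.
  rewrite mulr1; have [tau /le_trans h] := Ud z (set_mem Wz).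
  by apply: le_trans (h _ (lexx _)); rewrite lerD2r; exact: sigmaP.2.
Qed.

End MinibatchCost.

(** * Weak limits of couplings *)

Section CostLimit.
Local Open Scope ereal_scope.
Variables (R : realType) (d : nat).
Local Notation Rd := 'rV[R]_d.
Local Notation X := (Rd * Rd)%type.

(** The factor 2 comes from [|x - y|^2 <= 2 |x|^2 + 2 |y|^2]. A function of one marginal only, so
    its mean is the same for all couplings: this is the uniform integrability. *)
Definition moment_tail (k : nat) (x : Rd) : R :=
  Num.max 0%R (2 * enorm x ^+ 2 - k%:R)%R.

Lemma moment_tail_ge0 k x : (0 <= moment_tail k x)%R.
Proof. by rewrite le_max lexx. Qed.

Lemma moment_tail_le k x : (moment_tail k x <= 2 * enorm x ^+ 2)%R.
Proof. by rewrite ge_max gerBl ler0n andbT mulr_ge0 ?sqr_ge0. Qed.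

Lemma measurable_moment_tail k : measurable_fun setT (moment_tail k).
Proof.
apply: measurable_maxr => //; apply: measurable_funB => //.
by apply: measurable_funM => //; apply: measurable_funX; exact: measurable_fun_enorm.
Qed.

Lemma moment_tail_cvg0 (nu : probability Rd R) : P2 nu ->
  \int[nu]_x (moment_tail k x)%:E @[k --> \oo] --> 0.
Proof.
move=> nu2.
have m2 : measurable_fun setT (fun x : Rd => (2 * enorm x ^+ 2)%:E).
  apply/measurable_EFinP; apply: measurable_funM => //; apply: measurable_funX.
  exact: measurable_fun_enorm.
have -> : 0 = \int[nu]_(x in setT) cst 0 x by rewrite integral0.
apply: (@dominated_cvg _ _ _ nu setT measurableT _ _ (fun x => (2 * enorm x ^+ 2)%:E)).
- by move=> k; apply/measurable_EFinP; exact: measurable_moment_tail.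
- move=> x _; apply: cvg_EFin; first by apply: nearW.
  apply: cvg_near_cst; near=> k; rewrite /moment_tail /=; apply/max_idPl.
  by rewrite subr_le0; near: k; exact: nbhs_infty_ger.
- by [].
- apply/integrableP; split => //.
  rewrite (eq_integral (fun x => 2%:E * (enorm x ^+ 2)%:E)); last first.
    by move=> x _; rewrite gee0_abs ?EFinM// lee_fin mulr_ge0 ?sqr_ge0.
  rewrite ge0_integralZl//.
  + by rewrite lte_mul_pinfty.
  + apply/measurable_EFinP/measurable_funX; exact: measurable_fun_enorm.
  + by move=> x _; rewrite lee_fin sqr_ge0.
- move=> k x _; rewrite gee0_abs ?lee_fin ?moment_tail_ge0//.
  exact: moment_tail_le.
Unshelve. all: by end_near. Qed.

(** The truncation level [2 k] is shared equally between the two marginals. *)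
Lemma cost_le_truncation_tails k (p : X) :
  (enorm (p.1 - p.2) ^+ 2 <= Num.min (enorm (p.1 - p.2) ^+ 2) (2 * k%:R) +
    (moment_tail k p.1 + moment_tail k p.2))%R.
Proof.
have t1 : (2 * enorm p.1 ^+ 2 - k%:R <= moment_tail k p.1)%R by rewrite le_max lexx orbT.
have t2 : (2 * enorm p.2 ^+ 2 - k%:R <= moment_tail k p.2)%R by rewrite le_max lexx orbT.
have s1 := moment_tail_ge0 k p.1; have s2 := moment_tail_ge0 k p.2.
have := ler_enormD p.1 (- p.2); rewrite enormN => h.
have h2 : (enorm (p.1 - p.2) ^+ 2 <= (enorm p.1 + enorm p.2) ^+ 2)%R.
  by rewrite ler_sqr ?nnegrE ?addr_ge0 ?enorm_ge0.
have := sqr_ge0 (enorm p.1 - enorm p.2)%R.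
rewrite sqrrB; rewrite sqrrD in h2 => h3.
by case: (leP (enorm (p.1 - p.2) ^+ 2)%R (2 * k%:R)%R) => _; lra.
Qed.

Variables (mu0 mu1 : probability Rd R).
Hypotheses (mu02 : P2 mu0) (mu12 : P2 mu1).

Lemma coupling_integral_fst (g : probability X R) (h : Rd -> \bar R) :
  coupling mu0 mu1 g -> measurable_fun setT h -> (forall x, 0 <= h x) ->
  \int[g]_p h p.1 = \int[mu0]_x h x.
Proof.
move=> [_ g0 _] mh h0; rewrite -(ge0_integral_pushforwardT g measurable_fst mh h0).
by apply: eq_measure_integral => // A mA _; exact: g0.
Qed.

Lemma coupling_integral_snd (g : probability X R) (h : Rd -> \bar R) :
  coupling mu0 mu1 g -> measurable_fun setT h -> (forall x, 0 <= h x) ->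
  \int[g]_p h p.2 = \int[mu1]_x h x.
Proof.
move=> [_ _ g1] mh h0; rewrite -(ge0_integral_pushforwardT g measurable_snd mh h0).
by apply: eq_measure_integral => // A mA _; exact: g1.
Qed.

Lemma transport_cost_ge0 (g : probability X R) : 0 <= transport_cost g.
Proof. by apply: integral_ge0 => p _; rewrite lee_fin sqr_ge0. Qed.

Lemma coupling_cost_lty (g : probability X R) :
  coupling mu0 mu1 g -> transport_cost g < +oo.
Proof.
move=> [gfin _ _].
apply: (@le_lt_trans _ _ (2%:E * \int[g]_p (enorm p.1 ^+ 2 + enorm p.2 ^+ 2)%:E)); last first.
  by rewrite lte_mul_pinfty.
have m2 : measurable_fun setT (fun p : X => (enorm p.1 ^+ 2 + enorm p.2 ^+ 2)%:E).
  by apply/measurable_EFinP; exact: measurable_pair_sqnorm.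
rewrite -ge0_integralZl//; last by move=> p _; rewrite lee_fin addr_ge0 ?sqr_ge0.
apply: ge0_le_integral => //.
- by move=> p _; rewrite lee_fin sqr_ge0.
- exact: measurable_transport_integrand.
- exact: measurable_funeM.
- move=> p _; rewrite -EFinM lee_fin.
  have := ler_enormD p.1 (- p.2); rewrite enormN => h.
  have h2 : (enorm (p.1 - p.2) ^+ 2 <= (enorm p.1 + enorm p.2) ^+ 2)%R.
    by rewrite ler_sqr ?nnegrE ?addr_ge0 ?enorm_ge0.
  have := sqr_ge0 (enorm p.1 - enorm p.2)%R.
  rewrite sqrrB; rewrite sqrrD in h2 => h3; lra.
Qed.

Definition truncated_cost (k : nat) (p : X) : R :=
  Num.min (enorm (p.1 - p.2)%R ^+ 2)%R (2 * k%:R)%R.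

Lemma truncated_cost_ge0 k p : (0 <= truncated_cost k p)%R.
Proof. by rewrite le_min sqr_ge0 mulr_ge0. Qed.

Lemma measurable_truncated_cost k : measurable_fun setT (truncated_cost k).
Proof.
have /measurable_EFinP mc := @measurable_transport_integrand R d.
exact: measurable_minr.
Qed.

Lemma enormB_continuous : continuous (fun p : X => enorm (p.1 - p.2)%R).
Proof.
move=> p; apply: (@continuous_comp _ _ _ (fun p : X => p.1 - p.2)%R (@enorm R d)).
  by apply: cvgB; [exact: cvg_fst|exact: cvg_snd].
exact: enorm_continuous.
Qed.

Lemma truncated_cost_continuous k : continuous (truncated_cost k).
Proof.
apply: continuous_minr => p; last exact: cst_continuous.
apply: (@continuous_comp _ _ _ (fun p : X => enorm (p.1 - p.2)%R) (fun y : R => y ^+ 2)%R).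
  exact: enormB_continuous.
exact: exprn_continuous.
Qed.

Lemma bounded_funP_le (T : Type) (f : T -> R) (M : R) :
  (forall x, `|f x| <= M)%R -> bounded_fun f.
Proof.
move=> fM; exists M; split; first exact: num_real.
by move=> N MN x _; exact: le_trans (fM x) (ltW MN).
Qed.

Lemma truncated_cost_bounded k : bounded_fun (truncated_cost k).
Proof.
apply: (@bounded_funP_le _ _ (2 * k%:R)) => p.
by rewrite ger0_norm ?truncated_cost_ge0// ge_min lexx orbT.
Qed.

Lemma truncated_cost_cvg (g : probability X R) :
  \int[g]_p (truncated_cost k p)%:E @[k --> \oo] --> transport_cost g.
Proof.
have mk k : measurable_fun setT (fun p => (truncated_cost k p)%:E).
  by apply/measurable_EFinP; exact: measurable_truncated_cost.
have := @cvg_monotone_convergence _ _ _ g setT measurableT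
  (fun k p => (truncated_cost k p)%:E) mk _ _.
rewrite (_ : \int[g]_x _ = transport_cost g); last first.
  apply: eq_integral => p _; apply/cvg_lim => //; apply: cvg_EFin; first exact: nearW.
  apply: cvg_near_cst; near=> k; rewrite /truncated_cost /=; apply/min_idPl.
  by rewrite -ler_pdivrMl//; near: k; exact: nbhs_infty_ger.
apply; first by move=> k p _; rewrite lee_fin truncated_cost_ge0.
move=> p _ m n mn; rewrite lee_fin /truncated_cost le_min !ge_min lexx/=.
by apply/orP; right; rewrite ler_pM2l// ler_nat.
Unshelve. all: by end_near. Qed.

(** Truncated costs are continuous and bounded, hence pass to the weak limit at fixed [k]; the
    truncation error [eps k] does not depend on [n], so [k] can be sent to infinity afterwards. *)
Lemma cost_weak_limit (g_ : nat -> probability X R) (g : probability X R) (L : \bar R) :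
  (forall n, coupling mu0 mu1 (g_ n)) -> weak_cvg g_ g ->
  transport_cost (g_ n) @[n --> \oo] --> L -> transport_cost g = L.
Proof.
move=> cg wg gL.
have mk k : measurable_fun setT (fun p => (truncated_cost k p)%:E).
  by apply/measurable_EFinP; exact: measurable_truncated_cost.
have tk k : \int[g_ n]_p (truncated_cost k p)%:E @[n --> \oo] -->
    \int[g]_p (truncated_cost k p)%:E.
  by apply: wg; [exact: truncated_cost_continuous|exact: truncated_cost_bounded].
pose eps k := \int[mu0]_x (moment_tail k x)%:E + \int[mu1]_x (moment_tail k x)%:E.
have eps0 : eps k @[k --> \oo] --> 0.
  by rewrite -(adde0 0); apply: cvgeD => //; exact: moment_tail_cvg0.
have mt k : measurable_fun setT (fun x : Rd => (moment_tail k x)%:E).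
  by apply/measurable_EFinP; exact: measurable_moment_tail.
have upper n k : transport_cost (g_ n) <= \int[g_ n]_p (truncated_cost k p)%:E + eps k.
  rewrite /eps -(coupling_integral_fst (cg n) (mt k)); last first.
    by move=> x; rewrite lee_fin moment_tail_ge0.
  rewrite -(coupling_integral_snd (cg n) (mt k)); last first.
    by move=> x; rewrite lee_fin moment_tail_ge0.
  have m1 : measurable_fun setT (fun p : X => (moment_tail k p.1)%:E).
    exact: (measurableT_comp (mt k) measurable_fst).
  have m2 : measurable_fun setT (fun p : X => (moment_tail k p.2)%:E).
    exact: (measurableT_comp (mt k) measurable_snd).
  rewrite -ge0_integralD//; last 2 first.
  - by move=> x _; rewrite lee_fin moment_tail_ge0.
  - by move=> x _; rewrite lee_fin moment_tail_ge0.
  rewrite -ge0_integralD//; last 3 first.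
  - by move=> x _; rewrite lee_fin truncated_cost_ge0.
  - by move=> x _; rewrite -EFinD lee_fin addr_ge0 ?moment_tail_ge0.
  - exact: emeasurable_funD.
  apply: ge0_le_integral => //.
  - by move=> p _; rewrite lee_fin sqr_ge0.
  - exact: measurable_transport_integrand.
  - by apply: emeasurable_funD => //; exact: emeasurable_funD.
  - by move=> p _; rewrite -!EFinD lee_fin; exact: cost_le_truncation_tails.
have lower n k : \int[g_ n]_p (truncated_cost k p)%:E <= transport_cost (g_ n).
  apply: ge0_le_integral => //.
  - by move=> p _; rewrite lee_fin truncated_cost_ge0.
  - exact: measurable_transport_integrand.
  - by move=> p _; rewrite lee_fin ge_min lexx.
have lowerL k : \int[g]_p (truncated_cost k p)%:E <= L.
  rewrite -(cvg_lim _ (tk k))// -(cvg_lim _ gL)//; apply: lee_lim.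
  - by apply/cvg_ex; exists (\int[g]_p (truncated_cost k p)%:E); exact: tk.
  - by apply/cvg_ex; exists L.
  - by apply: nearW => n; exact: lower.
apply/eqP; rewrite eq_le; apply/andP; split.
  rewrite -(cvg_lim _ (@truncated_cost_cvg g))//; apply: lime_le.
    by apply/cvg_ex; exists (transport_cost g); exact: truncated_cost_cvg.
  by apply: nearW => k; exact: lowerL.
have upperL k : L <= transport_cost g + eps k.
  apply: (@le_trans _ _ (\int[g]_p (truncated_cost k p)%:E + eps k)); last first.
    apply: leeD2r; apply: ge0_le_integral => //.
    - by move=> p _; rewrite lee_fin truncated_cost_ge0.
    - exact: measurable_transport_integrand.
    - by move=> p _; rewrite lee_fin ge_min lexx.
  have tke : \int[g_ n]_p (truncated_cost k p)%:E + eps k @[n --> \oo] -->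
      \int[g]_p (truncated_cost k p)%:E + eps k.
    apply: cvgeD; [|exact: tk|exact: cvg_cst].
    apply: ge0_adde_def; rewrite inE.
      by apply: integral_ge0 => p _; rewrite lee_fin truncated_cost_ge0.
    by rewrite adde_ge0//; apply: integral_ge0 => x _; rewrite lee_fin moment_tail_ge0.
  rewrite -(cvg_lim _ tke)// -(cvg_lim _ gL)//; apply: lee_lim.
  - by apply/cvg_ex; exists L.
  - by apply/cvg_ex; exists (\int[g]_p (truncated_cost k p)%:E + eps k).
  - by apply: nearW => n; exact: upper.
apply/lee_addgt0Pr => e e0.
have [k ke] : exists k, eps k < e%:E.
  apply: (@filter_ex _ \oo).
  apply: (eps0 [set y | y < e%:E]); apply: open_nbhs_nbhs; split.
    exact: open_ereal_lt_ereal.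
  by rewrite /= lte_fin.
by apply: le_trans (upperL k) _; rewrite leeD2l// ltW.
Qed.

End CostLimit.

(** * Cyclic monotonicity *)

Section CyclicMonotonicity.
Variables (R : realType) (d : nat).
Local Notation Rd := 'rV[R]_d.
Local Notation X := (Rd * Rd)%type.

(** A continuous minorant of the indicator of a ball, through which weak convergence yields lower
    bounds on masses. *)
Definition tent (z : X) (r : R) (p : X) : R :=
  Num.max 0 (1 - pair_sqnorm (p - z) / r ^+ 2).

Lemma measurable_pair_sqnormB (z : X) :
  measurable_fun setT (fun p : X => pair_sqnorm (p - z)).
Proof.
apply: measurable_funD; apply: measurable_funX; apply: measurable_fun_enorm;
  exact: measurable_fun_rVB.
Qed.

Lemma measurable_tent z r : measurable_fun setT (tent z r).
Proof.
apply: measurable_maxr => //; apply: measurable_funB => //.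
by apply: measurable_funM => //; exact: measurable_pair_sqnormB.
Qed.

Lemma pair_sqnormB_continuous (z : X) : continuous (fun p : X => pair_sqnorm (p - z)).
Proof.
move=> p; apply: (@cvgD _ _ _ (nbhs p)).
  apply: (@continuous_comp _ _ _ (fun p : X => enorm (p.1 - z.1)) (fun y : R => y ^+ 2)).
    apply: (@continuous_comp _ _ _ (fun p : X => p.1 - z.1) (@enorm R d)).
      by apply: cvgB; [exact: cvg_fst|exact: cvg_cst].
    exact: enorm_continuous.
  exact: exprn_continuous.
apply: (@continuous_comp _ _ _ (fun p : X => enorm (p.2 - z.2)) (fun y : R => y ^+ 2)).
  apply: (@continuous_comp _ _ _ (fun p : X => p.2 - z.2) (@enorm R d)).
    by apply: cvgB; [exact: cvg_snd|exact: cvg_cst].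
  exact: enorm_continuous.
exact: exprn_continuous.
Qed.

Lemma tent_continuous z r : continuous (tent z r).
Proof.
apply: continuous_maxr => p; first exact: cst_continuous.
apply: (@continuous_comp _ _ _ (fun p : X => pair_sqnorm (p - z))
  (fun y : R => 1 - y / r ^+ 2)); first exact: pair_sqnormB_continuous.
by apply: cvgB; [exact: cvg_cst|apply: cvgMl; exact: cvg_id].
Qed.

Lemma tent_ge0 z r p : 0 <= tent z r p.
Proof. by rewrite le_max lexx. Qed.

Lemma tent_le1 z r p : tent z r p <= 1.
Proof. by rewrite ge_max ler01 gerBl divr_ge0 ?pair_sqnorm_ge0 ?sqr_ge0. Qed.

Lemma tent_bounded z r : bounded_fun (tent z r).
Proof.
by apply: (@bounded_funP_le _ _ _ 1) => p; rewrite ger0_norm ?tent_ge0// tent_le1.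
Qed.

Lemma tent_le_indic z r p : 0 < r ->
  tent z r p <= \1_[set q | pair_sqnorm (q - z) < r ^+ 2] p.
Proof.
move=> r0; rewrite indicE; case: (boolP (p \in _)) => [_|]; first exact: tent_le1.
rewrite notin_setE /= => /negP; rewrite -leNgt => h.
by rewrite ge_max lexx subr_le0 ler_pdivlMr ?exprn_gt0// mul1r.
Qed.

(** The tent is 1 at [z], so the open set where it exceeds 1/2 has positive mass, and half of that
    mass bounds the integral from below. *)
Lemma supp_tent_integral_gt0 (g : probability X R) z r : supp g z -> 0 < r ->
  (0 < \int[g]_p (tent z r p)%:E)%E.
Proof.
move=> gz r0; pose V := [set p | 1 / 2 < tent z r p].
have oV : open V.
  rewrite (_ : V = tent z r @^-1` [set y | 1 / 2 < y])//.
  by apply: open_comp => [p _|]; [exact: tent_continuous|exact: open_gt].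
have mV : measurable V.
  have := @measurable_tent z r; rewrite /V => mt.
  rewrite (_ : mkset _ = setT `&` tent z r @^-1` `]1 / 2, +oo[%classic).
    exact: mt.
  by rewrite setTI; apply/seteqP; split => p; rewrite /= in_itv/= andbT.
have gV : (0 < g V)%E.
  apply: gz; split => //; rewrite /V/= /tent subrr /pair_sqnorm/= enorm0.
  by rewrite expr0n/= addr0 mul0r subr0 (max_idPr ler01); lra.
apply: (@lt_le_trans _ _ ((1 / 2)%:E * g V)%E).
  by rewrite mule_gt0// lte_fin; lra.
rewrite -[V]setIT -integral_indic// -ge0_integralZl//; last first.
  by apply/measurable_EFinP; exact/measurable_indicP.
apply: ge0_le_integral => //.
- apply: measurable_funeM; apply/measurable_EFinP; exact/measurable_indicP.
- by apply/measurable_EFinP; exact: measurable_tent.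
- move=> p _; rewrite -EFinM lee_fin indicE.
  case: (boolP (p \in V)) => [/set_mem Vp|_]; last by rewrite mulr0 tent_ge0.
  by rewrite mulr1 ltW.
Qed.

Lemma tent_integral_le (g : probability X R) z r : 0 < r ->
  (\int[g]_p (tent z r p)%:E <= g [set q | (pair_sqnorm (q - z)%R < r ^+ 2)%R])%E.
Proof.
move=> r0; set W := [set q | _].
have mW : measurable W.
  have mt := @measurable_pair_sqnormB z.
  rewrite (_ : W = setT `&` (fun p : X => pair_sqnorm (p - z)) @^-1` `]-oo, (r ^+ 2)[%classic).
    exact: mt.
  by rewrite setTI; apply/seteqP; split => p; rewrite /= in_itv.
rewrite -[W]setIT -integral_indic//; apply: ge0_le_integral => //.
- by move=> p _; rewrite lee_fin tent_ge0.
- by apply/measurable_EFinP; exact: measurable_tent.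
- by apply/measurable_EFinP; exact/measurable_indicP.
- by move=> p _; rewrite lee_fin tent_le_indic.
Qed.

(** The difference of squares is at most [2 r (2 A + 2 r)], and [r <= 1]. The displacement [2 r]
    allows [r] for each end of a pair. *)
Lemma sqnorm_close (a b : Rd) (r A : R) : enorm a <= A -> enorm (b - a) <= 2 * r ->
  0 <= r -> r <= 1 ->
  `|enorm b ^+ 2 - enorm a ^+ 2| <= 4 * r * (A + 1).
Proof.
move=> aA ba r0 r1.
have h1 : enorm b <= enorm a + 2 * r.
  by rewrite -(subrK a b) addrC; apply: le_trans (ler_enormD _ _) _; rewrite lerD2l.
have h2 : enorm a <= enorm b + 2 * r.
  rewrite -[in leLHS](subrK b a) addrC; apply: le_trans (ler_enormD _ _) _.
  by rewrite lerD2l enormB.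
have a0 := enorm_ge0 a; have b0 := enorm_ge0 b.
by rewrite ler_norml; apply/andP; split; nra.
Qed.

Lemma box_enorm_le (z p : X) (r : R) : 0 < r -> pair_sqnorm (p - z) < r ^+ 2 ->
  enorm (p.1 - z.1) <= r /\ enorm (p.2 - z.2) <= r.
Proof.
move=> r0 pz; have r0' := ltW r0; split; rewrite -ler_sqr ?nnegrE ?enorm_ge0//;
  apply: le_trans (ltW pz); rewrite /pair_sqnorm/= ?lerDl ?lerDr; exact: sqr_ge0.
Qed.

Lemma batch_gap_near (N : nat) (z : N.-tuple X) (tau : 'S_N) (delta : R) : (0 < N)%N ->
  batch_cost z tau + 2 * delta <= batch_cost z 1%g -> 0 < delta ->
  exists2 r : R, 0 < r & forall w : N.-tuple X,
    (forall i, pair_sqnorm (tnth w i - tnth z i) < r ^+ 2) ->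
    batch_cost w tau + delta <= batch_cost w 1%g.
Proof.
move=> N0 gap d0.
(* The sum over all pairs is a convenient bound for each distance, whatever the permutation. *)
pose A := \sum_(i < N) \sum_(j < N) enorm ((tnth z i).1 - (tnth z j).2).
have A0 : 0 <= A by apply: sumr_ge0 => i _; apply: sumr_ge0 => j _; exact: enorm_ge0.
have zA i j : enorm ((tnth z i).1 - (tnth z j).2) <= A.
  rewrite /A (bigD1 i)//= (bigD1 j)//= -addrA lerDl addr_ge0//.
    by apply: sumr_ge0 => k _; exact: enorm_ge0.
  by apply: sumr_ge0 => k _; apply: sumr_ge0 => l _; exact: enorm_ge0.
have Npos : 0 < N%:R :> R by rewrite ltr0n.
(* Each batch cost has [N] terms and so moves by at most [delta / 2]; the two together consume
   [delta] of the gap [2 * delta]. *)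
pose eta := delta / (2 * N%:R).
have eta0 : 0 < eta by rewrite divr_gt0// mulr_gt0.
have A4 : 0 < 4 * (A + 1) by rewrite mulr_gt0// ltr_wpDl.
pose r := Num.min 1 (eta / (4 * (A + 1))).
have r0 : 0 < r by rewrite lt_min ltr01 divr_gt0.
have r1 : r <= 1 by rewrite ge_min lexx.
have rA : 4 * r * (A + 1) <= eta.
  have : r * (4 * (A + 1)) <= eta by rewrite -ler_pdivlMr// ge_min lexx orbT.
  by lra.
exists r => // w wz.
have close i j : `|enorm ((tnth w i).1 - (tnth w j).2) ^+ 2 -
    enorm ((tnth z i).1 - (tnth z j).2) ^+ 2| <= eta.
  apply: le_trans rA; apply: sqnorm_close => //; last exact: ltW.
  have [h1 _] := box_enorm_le r0 (wz i); have [_ h2] := box_enorm_le r0 (wz j).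
  have -> : (tnth w i).1 - (tnth w j).2 - ((tnth z i).1 - (tnth z j).2) =
      ((tnth w i).1 - (tnth z i).1) - ((tnth w j).2 - (tnth z j).2).
    by apply/rowP => k; rewrite !mxE; ring.
  apply: le_trans (ler_enormD _ _) _; rewrite enormN.
  by rewrite mulr_natl mulr2n lerD.
have etaN : \sum_(i < N) eta = delta / 2.
  by rewrite sumr_const card_ord -mulr_natr /eta; field; rewrite gt_eqF.
have upper : batch_cost w tau <= batch_cost z tau + \sum_(i < N) eta.
  rewrite -big_split/=; apply: ler_sum => i _.
  by have := close i (tau i); rewrite ler_distl => /andP[_].
have lower : batch_cost z 1%g <= batch_cost w 1%g + \sum_(i < N) eta.
  rewrite -big_split/=; apply: ler_sum => i _.
  by have := close i ((1%g : 'S_N) i); rewrite ler_distl lerBlDr => /andP[].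
rewrite etaN in upper lower; lra.
Qed.

(** A violation of cyclic monotonicity at [z] would separate the limits of the two cost sequences by
    a positive amount. *)
Lemma minibatch_fixed_cost_cyclic (N : nat) (sigma : N.-tuple X -> 'S_N)
    (g_ gN_ : nat -> probability X R) (g : probability X R) (L : R) :
  (0 < N)%N -> ot_selection sigma ->
  (forall n A, measurable A -> gN_ n A = minibatch_ot sigma (g_ n) A) ->
  transport_cost (g_ n) @[n --> \oo] --> L%:E ->
  transport_cost (gN_ n) @[n --> \oo] --> L%:E ->
  weak_cvg g_ g -> cyclically_monotone N g.
Proof.
move=> N0 sP gNE gL gNL wg z zsupp tau; rewrite leNgt; apply/negP => lt.
pose delta := (batch_cost z 1%g - batch_cost z tau) / 2.
have d0 : 0 < delta by rewrite divr_gt0// subr_gt0.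
have [r r0 rP] : exists2 r : R, 0 < r & forall w : N.-tuple X,
    (forall i, pair_sqnorm (tnth w i - tnth z i) < r ^+ 2) ->
    batch_cost w tau + delta <= batch_cost w 1%g.
  by apply: batch_gap_near => //; rewrite /delta; lra.
pose U i : set X := [set q | pair_sqnorm (q - tnth z i) < r ^+ 2].
have mU i : measurable (U i).
  have mt := @measurable_pair_sqnormB (tnth z i).
  rewrite (_ : U i = setT `&` (fun p : X => pair_sqnorm (p - tnth z i)) @^-1` `]-oo, (r ^+ 2)[%classic).
    exact: mt.
  by rewrite setTI; apply/seteqP; split => p; rewrite /= in_itv.
pose I i := (\int[g]_p (tent (tnth z i) r p)%:E)%E.
have I0 i : (0 < I i)%E by exact: supp_tent_integral_gt0.
have Ifin i : I i \is a fin_num.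
  rewrite ge0_fin_numE ?ltW//; apply: le_lt_trans (tent_integral_le _ _ r0) _.
  apply: le_lt_trans (probability_le1 _ (mU i)) (ltry _).
(* Half of the limiting tent integral: a strict lower bound, hence valid from some rank on. *)
pose b i := fine (I i) / 2.
have b0 i : 0 < b i by rewrite divr_gt0// fine_gt0// I0 ltey_eq Ifin.
have bI i : ((b i)%:E < I i)%E.
  by rewrite -(fineK (Ifin i)) lte_fin /b; have := b0 i; rewrite /b; lra.
(* There are finitely many boxes, so one rank serves them all. *)
have near_b : \forall n \near \oo, forall i, ((b i)%:E <= g_ n (U i))%E.
  apply: filter_forall => i.
  have ci := wg _ (@tent_continuous (tnth z i) r) (@tent_bounded (tnth z i) r).
  have : \forall n \near \oo, ((b i)%:E < \int[g_ n]_p (tent (tnth z i) r p)%:E)%E.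
    apply: (ci [set y | ((b i)%:E < y)%E]); apply: open_nbhs_nbhs; split => //=.
    exact: open_ereal_gt_ereal.
  apply: filterS => n /ltW h; apply: le_trans h _; exact: tent_integral_le.
pose beta := \prod_(i < N) b i.
have beta0 : 0 < beta by apply: prodr_gt0.
have gap n : (forall i, ((b i)%:E <= g_ n (U i))%E) ->
    (N%:R%:E * transport_cost (gN_ n) + (delta * beta)%:E <=
     N%:R%:E * transport_cost (g_ n))%E.
  move=> bn; apply: le_trans (minibatch_cost_gap sP (gNE n) N0 mU (ltW d0) _).
    apply: leeD2l; rewrite EFinM; apply: lee_wpmul2l; first by rewrite lee_fin ltW.
    (* Nonnegativity of the partial products is carried along because multiplying inequalities
       requires it. *)
    suff : 0 <= beta /\ (beta%:E <= \prod_(i < N) g_ n (U i))%E by case.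
    apply: (big_ind2 (fun (x : R) (y : \bar R) => 0 <= x /\ (x%:E <= y)%E)) => //.
      move=> x y x' y' [x0 xy] [x0' xy']; split; first exact: mulr_ge0.
      by rewrite EFinM; apply: lee_pmul => //; rewrite lee_fin.
    by move=> i _; split; [exact: ltW|exact: bn].
  by move=> w wU; exists tau; exact: rP.
have cL : (N%:R%:E * transport_cost (g_ n) @[n --> \oo] --> N%:R%:E * L%:E)%E.
  exact: cvgeZl.
have cNL : (N%:R%:E * transport_cost (gN_ n) + (delta * beta)%:E @[n --> \oo] -->
    N%:R%:E * L%:E + (delta * beta)%:E)%E.
  by apply: cvgeD; [rewrite -EFinM|exact: cvgeZl|exact: cvg_cst].
(* The gap inequality in the limit; [L] is finite, so it forces [delta * beta <= 0]. *)
have : (N%:R%:E * L%:E + (delta * beta)%:E <= N%:R%:E * L%:E)%E.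
  rewrite -{1}(cvg_lim _ cNL)// -(cvg_lim _ cL)//; apply: lee_lim.
  - by apply/cvg_ex; eexists; exact: cNL.
  - by apply/cvg_ex; eexists; exact: cL.
  - by apply: filterS near_b => n; exact: gap.
rewrite -EFinM -EFinD lee_fin gerDl leNgt => /negP; apply.
by rewrite mulr_gt0.
Qed.

End CyclicMonotonicity.

(** * Interlacing of the two cost sequences and conclusion *)

Lemma cvg_subseq_increasing (T : topologicalType) (u : nat -> T) (l : T)
    (phi : nat -> nat) : {homo phi : m n / (m < n)%N} ->
  u n @[n --> \oo] --> l -> u (phi n) @[n --> \oo] --> l.
Proof.
move=> incr ul.
have phi_ge n : (n <= phi n)%N.
  by elim: n => // n IHn; apply: leq_ltn_trans IHn _; exact: incr.
apply: cvg_trans ul => A [M _ hM]; exists M => // n /= Mn.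
by apply: hM => /=; exact: leq_trans (phi_ge n).
Qed.

Unset Implicit Arguments.

Theorem theorem11 (R : realType) (d N : nat)
    (mu0 mu1 : probability 'rV[R]_d R)
    (sigma : N.-tuple ('rV[R]_d * 'rV[R]_d)%type -> 'S_N)
    (gamma_ gammaN_ : nat -> probability ('rV[R]_d * 'rV[R]_d)%type R)
    (gamma gammaN : probability ('rV[R]_d * 'rV[R]_d)%type R) :
  (2 <= N)%N ->
  P2 mu0 -> P2 mu1 ->
  ot_selection sigma ->
  (forall n, coupling mu0 mu1 (gamma_ n)) ->
  (forall n, coupling mu0 mu1 (gammaN_ n)) ->
  (forall n A, measurable A -> gammaN_ n A = minibatch_ot sigma (gamma_ n) A) ->
  (forall n, weak_rectified (gammaN_ n) (gamma_ n.+1)) ->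
  weak_limit_point gamma_ gamma ->
  weak_limit_point gammaN_ gammaN ->
  cyclically_monotone N gamma /\
  (\int[gamma]_p (enorm (p.1 - p.2) ^+ 2)%:E =
   \int[gammaN]_p (enorm (p.1 - p.2) ^+ 2)%:E)%E.
Proof.
move=> N2 mu02 mu12 sP cg cgN gNE rect [phi incr wphi] [phi' incr' wphi'].
have N0 : (0 < N)%N by exact: leq_trans N2.
pose a n := transport_cost (gamma_ n); pose b n := transport_cost (gammaN_ n).
have ba n : (b n <= a n)%E.
  (* Zero gap on the whole space, with the identity as its own competitor. *)
  have := @minibatch_cost_gap R d N sigma (gamma_ n) (gammaN_ n) sP (gNE n)
    (fun=> setT) 0 N0 (fun=> measurableT) (lexx 0).
  rewrite mul0e adde0 lee_pmul2l//; first by apply=> z _; exists 1%g; rewrite addr0.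
  by rewrite lte_fin ltr0n.
have ab n : (a n.+1 <= b n)%E.
  by apply: weak_rectified_cost_le; [exact: coupling_cost_lty (cgN n)|exact: rect].
have a_nincr : nonincreasing_seq a.
  by apply/nonincreasing_seqP => n; exact: le_trans (ab n) (ba n).
have aL := ereal_nonincreasing_cvgn a_nincr.
set L := ereal_inf _ in aL.
have Lfin : L \is a fin_num.
  rewrite ge0_fin_numE.
    apply: le_lt_trans (coupling_cost_lty (cg 0%N)).
    by apply: ereal_inf_lbound; exists 0%N.
  rewrite -(cvg_lim _ aL)//; apply: lime_ge; first by apply/cvg_ex; exists L.
  by apply: nearW => n; exact: transport_cost_ge0.
have bL : (b n @[n --> \oo] --> L)%E.
  apply: (@squeeze_cvge _ _ _ _ (fun n => a n.+1) _ a) => //.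
    by apply: nearW => n; rewrite ab ba.
  by rewrite cvg_shiftS.
(* Both sequences are read along [phi], which keeps each coupling next to its own minibatch step;
   [phi'] enters only in the equality of costs. *)
have aphi := cvg_subseq_increasing incr aL.
have bphi := cvg_subseq_increasing incr bL.
split.
  apply: (@minibatch_fixed_cost_cyclic R d N sigma (gamma_ \o phi) (gammaN_ \o phi)
    gamma (fine L)) => //.
  - by move=> n A mA; exact: gNE.
  - by rewrite fineK.
  - by rewrite fineK.
transitivity L.
  exact: (cost_weak_limit mu02 mu12 (fun n => cg (phi n)) wphi aphi).
symmetry; apply: (cost_weak_limit mu02 mu12 (fun n => cgN (phi' n)) wphi').
exact: cvg_subseq_increasing incr' bL.
Qed.
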